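(* Let $\mathcal P$, $\mathcal M$, $(-)^*$ be data satisfying conditions (A1)–(A6) of the context, with associated category with zero morphisms $\mathcal D$ and kernel $M\colon \mathcal D^{\mathrm{op}}\times\mathcal P\to 1/\mathrm{Set}$. Let $\mathcal X$ be any additive category in which idempotents split and finite direct sums exist. Then the adjunction $\widehat M\dashv\widetilde M$, with $\widehat M\colon[\mathcal D,\mathcal X]_{\mathrm{pt}}\to[\mathcal P,\mathcal X]$ and $\widetilde M\colon[\mathcal P,\mathcal X]\to[\mathcal D,\mathcal X]_{\mathrm{pt}}$, is an equivalence of categories $[\mathcal P,\mathcal X]\simeq[\mathcal D,\mathcal X]_{\mathrm{pt}}$.
   Context: Setting. $\mathcal P$ is a category, $\mathcal M$ is a subcategory of $\mathcal P$ containing all isomorphisms of $\mathcal P$, and $(-)^*\colon\mathcal M^{\mathrm{op}}\to\mathcal P$ is a functor which is the identity on objects and satisfies $m^*\circ m=1$ for all $m\in\mathcal M$. For an object $A$, $\mathrm{Sub}A$ is the partially ordered set of isomorphism classes of morphisms $m\colon U\to A$ in $\mathcal M$ with codomain $A$, where $m\preceq n$ iff $m=n\circ f$ for some $f$. We write $U\preceq_m A$ for the element represented by $m\colon U\to A$, and $U\prec_m A$ if moreover $m$ is not invertible. $\mathcal R$ is the class of morphisms $r$ of $\mathcal P$ such that whenever $r=m\circ x\circ n^*$ with $m,n\in\mathcal M$, both $m$ and $n$ are invertible. $\mathcal S$ is the class of morphisms of the form $r\circ m^*$ with $r\in\mathcal R$, $m\in\mathcal M$. Conditions: (A1) Every morphism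 $f$ of $\mathcal P$ factors as $f=n\circ r\circ m^*$ with $m,n\in\mathcal M$, $r\in\mathcal R$, and $m,n,r$ are unique up to isomorphism. (A2) If $r,r'\in\mathcal R$ are composable then $r'\circ r\in\mathcal S$. (A3) If $r\in\mathcal R$, $m\in\mathcal M$ and $m^*\circ r\in\mathcal R$, then $m$ is invertible. (A4) The class of morphisms $m\circ n^*$ with $m,n\in\mathcal M$ is closed under composition. (A5) Each $\mathrm{Sub}A$ is finite. (A6) For each object $A$, the relation $R_A$ on $\mathrm{Sub}A$ given by $m\,R_A\,n$ iff $m^*\circ n\in\mathcal M$ is contained in an antisymmetric transitive relation on $\mathrm{Sub}A$. $1/\mathrm{Set}$ is the category of pointed sets with smash product $\wedge$; $\mathrm p\Lambda$ is the set $\Lambda$ with a base point $0$ freely added. $\mathcal D$ is the category with zero morphisms (i.e. $1/\mathrm{Set}$-enriched category) with the objects of $\mathcal P$ and with $\mathcal D(A,B)=\mathrm p\{r\in\mathcal R\mid r\colon A\to B\}$; the composite in $\mathcal D$ of two morphisms of $\mathcal R$ is their composite in $\mathcal P$ if this lies in $\mathcal R$, and $0$ otherwise. $[\mathcal D,\mathcal X]_{\mathrm{pt}}$ is the category of zero-morphism-preserving functors $\mathcal D\to\mathcal X$; $[\mathcal P,\mathcal X]$ is the ordinary functor category. By (A1), each $u\colon A\to B$ in $\mathcal P$ factors, uniquely up to isomorphism, as $u=m_u\circ s_u$ with $s_u\colon A\to S_u$ in $\mathcal S$, $m_u\colon S_u\to B$ in $\mathcal M$. The kernel $M$ is the functor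 with $M(A,B)=\mathrm p\{u\in\mathcal P(A,B)\mid s_u\in\mathcal R\}$ and, for $r\colon A_1\to A$ in $\mathcal R$, $f\colon B\to B_1$ in $\mathcal P$, $M(r,f)u=f\circ u\circ r$ if $s_{fur}\in\mathcal R$ and $0$ otherwise. The functors of the adjunction are $\widehat M(F)B=\int^{A\in\mathcal D}M(A,B)\wedge FA$ (the $1/\mathrm{Set}$-enriched colimit of $F$ weighted by $M(-,B)$) and its right adjoint $\widetilde M(T)A=\int_{B}[M(A,B),TB]$ (the limit of $T$ weighted by $M(A,-)$). Concretely, $\widehat M(F)B\cong\sum_{S\preceq_m B}FS$, where for $f\colon A\to B$ in $\mathcal P$ and $m\colon U\to A$ in $\mathcal M$ one has $\widehat M(F)f\circ\mathrm{in}_m=\mathrm{in}_{m_{fm}}\circ F s_{fm}$ if $s_{fm}\in\mathcal R$, and $0$ otherwise; and $\widetilde M(T)A\cong\bigcap_{U\prec_m A}\ker T(m^*\colon A\to U)$, with $\widetilde M(T)r$ the restriction of $Tr$ for $r\in\mathcal R$. *)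

(* Defs.v *)
From HB Require Import structures.
From mathcomp Require Import all_boot all_order all_algebra.
From mathcomp Require Import boolp classical_sets cardinality.

Set Implicit Arguments.
Unset Strict Implicit.
Unset Printing Implicit Defensive.

Import GRing.Theory.

#[local] Obligation Tactic := idtac.

Reserved Notation "g \oc f" (at level 50, left associativity).

Record category := Category {
  ob :> Type;
  hom : ob -> ob -> Type;
  idc : forall A, hom A A;
  compc : forall A B C, hom B C -> hom A B -> hom A C;
  compcA : forall A B C D (h : hom C D) (g : hom B C) (f : hom A B),
    compc (compc h g) f = compc h (compc g f);
  comp1c : forall A B (f : hom A B), compc (idc B) f = f;
  compc1 : forall A B (f : hom A B), compc f (idc A) = f }.

Arguments hom {c} _ _.
Arguments idc {c} _.
Arguments compc {c A B C} _ _.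
Notation "g \oc f" := (compc g f).

Definition is_iso (C : category) (A B : C) (f : hom A B) : Prop :=
  exists g : hom B A, g \oc f = idc A /\ f \oc g = idc B.

Definition opc (C : category) : category :=
  @Category C (fun A B => @hom C B A) (fun A => idc A)
    (fun A B D g f => f \oc g)
    (fun A B D E h g f => esym (compcA f g h))
    (fun A B f => compc1 f) (fun A B f => comp1c f).

Section Product.
Variables C D : category.
Let phom (X Y : C * D) : Type := (hom X.1 Y.1 * hom X.2 Y.2)%type.

Program Definition prodc : category :=
  @Category (C * D)%type phom (fun X => (idc X.1, idc X.2))
    (fun X Y Z g f => (g.1 \oc f.1, g.2 \oc f.2)) _ _ _.
Next Obligation. by move=> *; rewrite /= !compcA. Qed.
Next Obligation. by move=> X Y [f g]; rewrite /= !comp1c. Qed.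
Next Obligation. by move=> X Y [f g]; rewrite /= !compc1. Qed.
End Product.

Record functor (C D : category) := Functor {
  fob :> C -> D;
  fmap : forall A B, hom A B -> hom (fob A) (fob B);
  fmap1 : forall A, fmap (idc A) = idc (fob A);
  fmapM : forall A B E (g : hom B E) (f : hom A B),
    fmap (g \oc f) = fmap g \oc fmap f }.

Arguments fmap {C D} _ {A B} _.

Record natTrans (C D : category) (F G : functor C D) := NatTrans {
  ntc :> forall A, hom (F A) (G A);
  nt_nat : forall A B (f : hom A B), ntc B \oc fmap F f = fmap G f \oc ntc A }.

Lemma natTrans_eq (C D : category) (F G : functor C D) (a b : natTrans F G) :
  (forall A, a A = b A) -> a = b.
Proof.
case: a => a an; case: b => b bn /= ab.
have eab : a = b by apply: functional_extensionality_dep.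
by case: _ / eab bn => bn; congr NatTrans; apply: Prop_irrelevance.
Qed.

Section FunctorCategory.
Variables C D : category.

Program Definition nt_id (F : functor C D) : natTrans F F :=
  @NatTrans _ _ F F (fun A => idc (F A)) _.
Next Obligation. by move=> *; rewrite comp1c compc1. Qed.

Program Definition nt_comp (F G H : functor C D)
    (b : natTrans G H) (a : natTrans F G) : natTrans F H :=
  @NatTrans _ _ F H (fun A => b A \oc a A) _.
Next Obligation.
by move=> F G H b a A B f; rewrite compcA nt_nat -compcA nt_nat compcA.
Qed.

Program Definition functorCat : category :=
  @Category (functor C D) (@natTrans C D) nt_id nt_comp _ _ _.
Next Obligation. by move=> *; apply: natTrans_eq => A /=; rewrite compcA. Qed.
Next Obligation. by move=> *; apply: natTrans_eq => A /=; rewrite comp1c. Qed.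
Next Obligation. by move=> *; apply: natTrans_eq => A /=; rewrite compc1. Qed.
End FunctorCategory.

Record adjunction (C D : category) (L : functor C D) (R : functor D C) :=
  Adjunction {
  adj_to : forall A B, hom (L A) B -> hom A (R B);
  adj_from : forall A B, hom A (R B) -> hom (L A) B;
  adj_toK : forall A B, cancel (@adj_to A B) (@adj_from A B);
  adj_fromK : forall A B, cancel (@adj_from A B) (@adj_to A B);
  adj_natl : forall A' A B (f : hom A' A) (g : hom (L A) B),
    adj_to (g \oc fmap L f) = adj_to g \oc f;
  adj_natr : forall A B B' (h : hom B B') (g : hom (L A) B),
    adj_to (h \oc g) = fmap R h \oc adj_to g }.

Definition adj_unit (C D : category) (L : functor C D) (R : functor D C)
    (adj : adjunction L R) (A : C) : hom A (R (L A)) :=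
  adj_to adj (idc (L A)).

Definition adj_counit (C D : category) (L : functor C D) (R : functor D C)
    (adj : adjunction L R) (B : D) : hom (L (R B)) B :=
  adj_from adj (idc (R B)).

Definition is_adjoint_equivalence (C D : category) (L : functor C D)
    (R : functor D C) (adj : adjunction L R) : Prop :=
  (forall A, is_iso (adj_unit adj A)) /\ (forall B, is_iso (adj_counit adj B)).

Record ptCategory := PtCategory {
  ptcat :> category;
  zeroc : forall A B : ptcat, hom A B;
  comp0c : forall (A B C : ptcat) (f : hom A B), zeroc B C \oc f = zeroc A C;
  compc0 : forall (A B C : ptcat) (f : hom B C), f \oc zeroc A B = zeroc A C }.

Arguments zeroc {p} A B.

Record ptFunctor (D X : ptCategory) := PtFunctor {
  ptfun :> functor D X;
  fmap0 : forall A B, fmap ptfun (zeroc A B) = zeroc (ptfun A) (ptfun B) }.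

Definition ptFunctorCat (D X : ptCategory) : category :=
  @Category (ptFunctor D X) (fun F G => natTrans F G) (fun F => nt_id F)
    (fun F G H b a => nt_comp b a)
    (fun F G H K => @compcA (functorCat D X) F G H K)
    (fun F G => @comp1c (functorCat D X) F G)
    (fun F G => @compc1 (functorCat D X) F G).

(* A functor C -> 1/Set, with pointed sets presented as a type together with
   a base point. *)
Record psFunctor (C : category) := PsFunctor {
  psob :> C -> Type;
  pspt : forall A, psob A;
  psmap : forall A B, hom A B -> psob A -> psob B;
  psmap_pt : forall A B (f : hom A B), psmap f (pspt A) = pspt B;
  psmap1 : forall A (w : psob A), psmap (idc A) w = w;
  psmapM : forall A B E (g : hom B E) (f : hom A B) (w : psob A),
    psmap (g \oc f) w = psmap g (psmap f w) }.

Arguments pspt {C} _ A.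
Arguments psmap {C} _ {A B} _ _.

(* A W-cocone with apex L is a 1/Set-natural transformation
   W => X(F -, L) of contravariant functors on D; its universality says that
   it induces X(L, Z) ~ [D^op, 1/Set](W, X(F -, Z)), naturally in Z. *)
Section WeightedColimit.
Variables (D X : ptCategory) (W : psFunctor (opc D)) (F : ptFunctor D X).

Record wcocone := WCocone {
  cc_apex : X;
  cc_leg : forall A, W A -> hom (F A) cc_apex;
  cc_leg_pt : forall A, cc_leg (pspt W A) = zeroc (F A) cc_apex;
  cc_leg_nat : forall (A1 A : D) (r : hom A1 A) (w : W A),
    cc_leg (psmap W (r : @hom (opc D) A A1) w) = cc_leg w \oc fmap F r }.

Definition is_wcolimit (c : wcocone) : Prop :=
  forall c' : wcocone, exists! h : hom (cc_apex c) (cc_apex c'),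
    forall A (w : W A), h \oc cc_leg c w = cc_leg c' w.

Record wcolimit := WColimit {
  wcolim_cocone :> wcocone;
  wcolimP : is_wcolimit wcolim_cocone }.

Definition wcolim_desc (c : wcolimit) (c' : wcocone) :
  hom (cc_apex c) (cc_apex c') := sval (cid (wcolimP c c')).

Lemma wcolim_descE (c : wcolimit) (c' : wcocone) A (w : W A) :
  wcolim_desc c c' \oc cc_leg c w = cc_leg c' w.
Proof. by rewrite /wcolim_desc; case: cid => h [/= + _]; apply. Qed.

Lemma wcolim_ext (c : wcolimit) (Z : X) (h k : hom (cc_apex c) Z) :
  (forall A (w : W A), h \oc cc_leg c w = k \oc cc_leg c w) -> h = k.
Proof.
move=> hk.
have pt A : k \oc cc_leg c (pspt W A) = zeroc (F A) Z.
  by rewrite cc_leg_pt compc0.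
have nat (A1 A : D) (r : hom A1 A) (w : W A) :
    k \oc cc_leg c (psmap W (r : @hom (opc D) A A1) w)
    = k \oc cc_leg c w \oc fmap F r.
  by rewrite cc_leg_nat compcA.
have [l [_ lu]] := wcolimP c (WCocone pt nat).
by rewrite -(lu h hk) -(lu k).
Qed.

End WeightedColimit.

(* Dually, a W-cone with apex L is a natural transformation W => X(L, T -).
   Here the indexing category J is an ordinary category, i.e. the
   1/Set-enriched one obtained from J by freely adding zero morphisms. *)
Section WeightedLimit.
Variables (J : category) (X : ptCategory) (W : psFunctor J) (T : functor J X).

Record wcone := WCone {
  cn_apex : X;
  cn_leg : forall B, W B -> hom cn_apex (T B);
  cn_leg_pt : forall B, cn_leg (pspt W B) = zeroc cn_apex (T B);
  cn_leg_nat : forall (B B1 : J) (f : hom B B1) (w : W B),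
    cn_leg (psmap W f w) = fmap T f \oc cn_leg w }.

Definition is_wlimit (c : wcone) : Prop :=
  forall c' : wcone, exists! h : hom (cn_apex c') (cn_apex c),
    forall B (w : W B), cn_leg c w \oc h = cn_leg c' w.

Record wlimit := WLimit {
  wlim_cone :> wcone;
  wlimP : is_wlimit wlim_cone }.

Definition wlim_lift (c : wlimit) (c' : wcone) :
  hom (cn_apex c') (cn_apex c) := sval (cid (wlimP c c')).

Lemma wlim_liftE (c : wlimit) (c' : wcone) B (w : W B) :
  cn_leg c w \oc wlim_lift c c' = cn_leg c' w.
Proof. by rewrite /wlim_lift; case: cid => h [/= + _]; apply. Qed.

Lemma wlim_ext (c : wlimit) (Z : X) (h k : hom Z (cn_apex c)) :
  (forall B (w : W B), cn_leg c w \oc h = cn_leg c w \oc k) -> h = k.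
Proof.
move=> hk.
have pt B : cn_leg c (pspt W B) \oc k = zeroc Z (T B).
  by rewrite cn_leg_pt comp0c.
have nat (B B1 : J) (f : hom B B1) (w : W B) :
    cn_leg c (psmap W f w) \oc k = fmap T f \oc (cn_leg c w \oc k).
  by rewrite cn_leg_nat compcA.
have [l [_ lu]] := wlimP c (WCone pt nat).
by rewrite -(lu h hk) -(lu k).
Qed.

End WeightedLimit.

(* A functor D^op x P -> 1/Set preserving zero morphisms in the variable D;
   the ordinary category P carries no zero morphisms. *)
Record kernel (D : ptCategory) (P : category) := Kernel {
  kfun :> psFunctor (prodc (opc D) P);
  kfun0 : forall (A1 A : D) (B B1 : P) (f : hom B B1) (w : kfun (A, B)),
    @psmap _ kfun (A, B) (A1, B1) (zeroc A1 A, f) w = pspt kfun (A1, B1) }.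

Section Kernel.
Variables (D : ptCategory) (P : category) (K : kernel D P).

Definition kact (A1 A : D) (B B1 : P) (r : hom A1 A) (f : hom B B1) :
  K (A, B) -> K (A1, B1) := @psmap _ K (A, B) (A1, B1) (r, f).

Lemma kactM (A2 A1 A : D) (B B1 B2 : P) (r : hom A1 A) (r' : hom A2 A1)
    (f : hom B B1) (f' : hom B1 B2) (w : K (A, B)) :
  kact (r \oc r') (f' \oc f) w = kact r' f' (kact r f w).
Proof. exact: (@psmapM _ K (A, B) (A1, B1) (A2, B2) (r', f') (r, f) w). Qed.

Lemma kact1 (A : D) (B : P) (w : K (A, B)) : kact (idc A) (idc B) w = w.
Proof. exact: (@psmap1 _ K (A, B)). Qed.

Lemma kact_pt (A1 A : D) (B B1 : P) (r : hom A1 A) (f : hom B B1) :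
  kact r f (pspt K (A, B)) = pspt K (A1, B1).
Proof. exact: psmap_pt. Qed.

(* The weight K(-, B). *)
Program Definition kcol (B : P) : psFunctor (opc D) :=
  @PsFunctor (opc D) (fun A => K (A, B)) (fun A => pspt K (A, B))
    (fun A A1 r => @kact A1 A B B r (idc B)) _ _ _.
Next Obligation. by move=> *; apply: kact_pt. Qed.
Next Obligation. by move=> *; apply: kact1. Qed.
Next Obligation.
move=> B A A1 A2 r' r w /=.
by rewrite -[X in kact _ X _ = _](comp1c (idc B)) (kactM r r').
Qed.

(* The weight K(A, -). *)
Program Definition krow (A : D) : psFunctor P :=
  @PsFunctor P (fun B => K (A, B)) (fun B => pspt K (A, B))
    (fun B B1 f => @kact A A B B1 (idc A) f) _ _ _.
Next Obligation. by move=> *; apply: kact_pt. Qed.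
Next Obligation. by move=> *; apply: kact1. Qed.
Next Obligation.
move=> A B B1 B2 f' f w /=.
by rewrite -[X in kact X _ _ = _](comp1c (idc A)); apply: kactM.
Qed.

Lemma kact_colrow (A1 A : D) (B B1 : P) (r : hom A1 A) (f : hom B B1)
    (w : K (A, B)) :
  kact (idc A1) f (kact r (idc B) w) = kact r (idc B1) (kact (idc A) f w).
Proof. by rewrite -!kactM !comp1c !compc1. Qed.

Variable X : ptCategory.
Variable colims : forall (F : ptFunctor D X) (B : P), wcolimit (kcol B) F.
Variable lims : forall (T : functor P X) (A : D), wlimit (krow A) T.

Section HatObject.
Variable F : ptFunctor D X.

Program Definition hat_cocone (B B1 : P) (f : hom B B1) : wcocone (kcol B) F :=
  @WCocone _ _ (kcol B) F (cc_apex (colims F B1))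
    (fun A (w : K (A, B)) =>
       cc_leg (colims F B1) (kact (idc A) f w : kcol B1 A)) _ _.
Next Obligation.
move=> B B1 f A; rewrite -(cc_leg_pt (colims F B1) A).
by congr (cc_leg _ _); exact: kact_pt.
Qed.
Next Obligation.
move=> B B1 f A1 A r w /=; rewrite kact_colrow.
exact: (cc_leg_nat (colims F B1) r (kact (idc A) f w : kcol B1 A)).
Qed.

Program Definition hat_ob : functor P X :=
  @Functor P X (fun B => cc_apex (colims F B))
    (fun B B1 f => wcolim_desc (colims F B) (hat_cocone f)) _ _.
Next Obligation.
move=> B; apply: wcolim_ext => A w.
by rewrite (wcolim_descE _ (hat_cocone _)) /= kact1 comp1c.
Qed.
Next Obligation.
move=> B B1 B2 g f; apply: wcolim_ext => A w.
rewrite (wcolim_descE _ (hat_cocone _)) compcA (wcolim_descE _ (hat_cocone f)).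
rewrite (wcolim_descE _ (hat_cocone g)) /= -kactM.
by rewrite compc1.
Qed.

Lemma hat_obE (A : D) (B B1 : P) (f : hom B B1) (w : kcol B A) :
  fmap hat_ob f \oc cc_leg (colims F B) w
  = cc_leg (colims F B1) (kact (idc A) f w : kcol B1 A).
Proof. exact: (wcolim_descE _ (hat_cocone f)). Qed.
End HatObject.

Section HatArrow.
Variables (F G : ptFunctor D X) (a : natTrans F G).

Program Definition hat_arr_cocone (B : P) : wcocone (kcol B) F :=
  @WCocone _ _ (kcol B) F (cc_apex (colims G B))
    (fun A w => cc_leg (colims G B) w \oc a A) _ _.
Next Obligation. by move=> B A /=; rewrite (cc_leg_pt (colims G B) A) comp0c. Qed.
Next Obligation.
move=> B A1 A r w /=.
by rewrite (cc_leg_nat (colims G B) r w) !compcA nt_nat.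
Qed.

Program Definition hat_arr : natTrans (hat_ob F) (hat_ob G) :=
  @NatTrans _ _ (hat_ob F) (hat_ob G)
    (fun B => wcolim_desc (colims F B) (hat_arr_cocone B)) _.
Next Obligation.
move=> B B1 f; apply: wcolim_ext => A w /=.
rewrite !compcA (wcolim_descE _ (hat_cocone F f)) /=.
rewrite !(wcolim_descE _ (hat_arr_cocone _)) /=.
by rewrite -compcA (wcolim_descE _ (hat_cocone G f)).
Qed.
End HatArrow.

Lemma hat_arrE (F G : ptFunctor D X) (a : natTrans F G) (A : D) (B : P)
    (w : kcol B A) :
  hat_arr a B \oc cc_leg (colims F B) w = cc_leg (colims G B) w \oc a A.
Proof. exact: (wcolim_descE _ (hat_arr_cocone a B)). Qed.

Program Definition hat : functor (ptFunctorCat D X) (functorCat P X) :=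
  @Functor (ptFunctorCat D X) (functorCat P X) hat_ob
    (fun F G a => hat_arr a) _ _.
Next Obligation.
move=> F; apply: natTrans_eq => B; apply: wcolim_ext => A w.
by rewrite hat_arrE /= comp1c compc1.
Qed.
Next Obligation.
move=> F G H b a; apply: natTrans_eq => B; apply: wcolim_ext => A w /=.
by rewrite compcA !hat_arrE -compcA hat_arrE compcA.
Qed.

Section TildeObject.
Variable T : functor P X.

Program Definition tilde_cone (A1 A : D) (r : hom A1 A) : wcone (krow A) T :=
  @WCone _ _ (krow A) T (cn_apex (lims T A1))
    (fun B (w : K (A, B)) =>
       cn_leg (lims T A1) (kact r (idc B) w : krow A1 B)) _ _.
Next Obligation.
move=> A1 A r B; rewrite -(cn_leg_pt (lims T A1) B).
by congr (cn_leg _ _); exact: kact_pt.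
Qed.
Next Obligation.
move=> A1 A r B B1 f w /=; rewrite -kact_colrow.
exact: (cn_leg_nat (lims T A1) f (kact r (idc B) w : krow A1 B)).
Qed.

Program Definition tilde_functor : functor D X :=
  @Functor D X (fun A => cn_apex (lims T A))
    (fun A1 A r => wlim_lift (lims T A) (tilde_cone r)) _ _.
Next Obligation.
move=> A; apply: wlim_ext => B w.
by rewrite (wlim_liftE _ (tilde_cone _)) /= kact1 compc1.
Qed.
Next Obligation.
move=> A2 A1 A r r'; apply: wlim_ext => B w.
rewrite (wlim_liftE _ (tilde_cone _)) -compcA (wlim_liftE _ (tilde_cone r)).
rewrite (wlim_liftE _ (tilde_cone r')) /= -kactM.
by rewrite compc1.
Qed.

Program Definition tilde_ob : ptFunctor D X := @PtFunctor _ _ tilde_functor _.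
Next Obligation.
move=> A1 A; apply: wlim_ext => B w.
rewrite (wlim_liftE _ (tilde_cone _)) /= /kact kfun0 compc0.
exact: (cn_leg_pt (lims T A1) B).
Qed.

Lemma tilde_obE (A1 A : D) (B : P) (r : hom A1 A) (w : krow A B) :
  cn_leg (lims T A) w \oc fmap tilde_ob r
  = cn_leg (lims T A1) (kact r (idc B) w : krow A1 B).
Proof. exact: (wlim_liftE _ (tilde_cone r)). Qed.
End TildeObject.

Section TildeArrow.
Variables (S T : functor P X) (a : natTrans S T).

Program Definition tilde_arr_cone (A : D) : wcone (krow A) T :=
  @WCone _ _ (krow A) T (cn_apex (lims S A))
    (fun B w => a B \oc cn_leg (lims S A) w) _ _.
Next Obligation. by move=> A B /=; rewrite (cn_leg_pt (lims S A) B) compc0. Qed.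
Next Obligation.
move=> A B B1 f w /=.
by rewrite (cn_leg_nat (lims S A) f w) -!compcA nt_nat.
Qed.

Program Definition tilde_arr : natTrans (tilde_ob S) (tilde_ob T) :=
  @NatTrans _ _ (tilde_ob S) (tilde_ob T)
    (fun A => wlim_lift (lims T A) (tilde_arr_cone A)) _.
Next Obligation.
move=> A1 A r; apply: wlim_ext => B w /=.
rewrite -!compcA (wlim_liftE _ (tilde_cone T r)) /=.
rewrite !(wlim_liftE _ (tilde_arr_cone _)) /=.
by rewrite compcA (wlim_liftE _ (tilde_cone S r)).
Qed.
End TildeArrow.

Lemma tilde_arrE (S T : functor P X) (a : natTrans S T) (A : D) (B : P)
    (w : krow A B) :
  cn_leg (lims T A) w \oc tilde_arr a A = a B \oc cn_leg (lims S A) w.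
Proof. exact: (wlim_liftE _ (tilde_arr_cone a A)). Qed.

Program Definition tilde : functor (functorCat P X) (ptFunctorCat D X) :=
  @Functor (functorCat P X) (ptFunctorCat D X) tilde_ob
    (fun S T a => tilde_arr a) _ _.
Next Obligation.
move=> T; apply: natTrans_eq => A; apply: wlim_ext => B w.
by rewrite tilde_arrE /= comp1c compc1.
Qed.
Next Obligation.
move=> S T U b a; apply: natTrans_eq => A; apply: wlim_ext => B w /=.
by rewrite -compcA !tilde_arrE compcA tilde_arrE compcA.
Qed.

(* Both sides of the adjunction are identified with the families
   K(A, B) -> X(FA, TB) natural in A and B. *)
Section Transpose.
Variables (F : ptFunctor D X) (T : functor P X).

Program Definition transp_cone (b : natTrans (hat_ob F) T) (A : D) :
    wcone (krow A) T :=
  @WCone _ _ (krow A) T (F A)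
    (fun B (w : K (A, B)) => b B \oc cc_leg (colims F B) (w : kcol B A)) _ _.
Next Obligation.
by move=> b A B /=; rewrite (cc_leg_pt (colims F B) A) compc0.
Qed.
Next Obligation.
move=> b A B B1 f w /=.
rewrite -compcA -(nt_nat b f) compcA; congr (_ \oc _).
by symmetry; apply: hat_obE.
Qed.

Program Definition transp (b : natTrans (hat_ob F) T) :
    natTrans F (tilde_ob T) :=
  @NatTrans _ _ F (tilde_ob T)
    (fun A => wlim_lift (lims T A) (transp_cone b A)) _.
Next Obligation.
move=> b A1 A r; apply: wlim_ext => B w /=.
rewrite -!compcA (wlim_liftE _ (tilde_cone T r)) /=.
rewrite !(wlim_liftE _ (transp_cone _ _)) /=.
by rewrite compcA -(cc_leg_nat (colims F B) r w).
Qed.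

Program Definition untransp_cocone (g : natTrans F (tilde_ob T)) (B : P) :
    wcocone (kcol B) F :=
  @WCocone _ _ (kcol B) F (T B)
    (fun A (w : K (A, B)) => cn_leg (lims T A) (w : krow A B) \oc g A) _ _.
Next Obligation.
by move=> g B A /=; rewrite (cn_leg_pt (lims T A) B) comp0c.
Qed.
Next Obligation.
move=> g B A1 A r w /=.
rewrite compcA (nt_nat g r) -compcA; congr (_ \oc _).
by symmetry; apply: tilde_obE.
Qed.

Program Definition untransp (g : natTrans F (tilde_ob T)) :
    natTrans (hat_ob F) T :=
  @NatTrans _ _ (hat_ob F) T
    (fun B => wcolim_desc (colims F B) (untransp_cocone g B)) _.
Next Obligation.
move=> g B B1 f; apply: wcolim_ext => A w /=.
rewrite !compcA (wcolim_descE _ (hat_cocone F f)) /=.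
rewrite !(wcolim_descE _ (untransp_cocone _ _)) /=.
by rewrite -compcA -(cn_leg_nat (lims T A) f w).
Qed.
End Transpose.

Lemma transpE (F : ptFunctor D X) (T : functor P X)
    (b : natTrans (hat_ob F) T) (A : D) (B : P) (w : K (A, B)) :
  cn_leg (lims T A) (w : krow A B) \oc transp b A
  = b B \oc cc_leg (colims F B) (w : kcol B A).
Proof. exact: (wlim_liftE _ (transp_cone b A)). Qed.

Lemma untranspE (F : ptFunctor D X) (T : functor P X)
    (g : natTrans F (tilde_ob T)) (A : D) (B : P) (w : K (A, B)) :
  untransp g B \oc cc_leg (colims F B) (w : kcol B A)
  = cn_leg (lims T A) (w : krow A B) \oc g A.
Proof. exact: (wcolim_descE _ (untransp_cocone g B)). Qed.

Program Definition kernel_adjunction : adjunction hat tilde :=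
  @Adjunction _ _ hat tilde transp untransp _ _ _ _.
Next Obligation.
move=> F T b; apply: natTrans_eq => B; apply: wcolim_ext => A w.
exact: etrans (untranspE _ _) (transpE _ _).
Qed.
Next Obligation.
move=> F T g; apply: natTrans_eq => A; apply: wlim_ext => B w.
exact: etrans (transpE _ _) (untranspE _ _).
Qed.
Next Obligation.
move=> F' F T f g; apply: natTrans_eq => A; apply: wlim_ext => B w.
apply: etrans (transpE _ _) _; rewrite /= compcA hat_arrE -compcA.
by rewrite -[RHS]compcA; congr (_ \oc _); symmetry; apply: transpE.
Qed.
Next Obligation.
move=> F T T' h g; apply: natTrans_eq => A; apply: wlim_ext => B w.
apply: etrans (transpE _ _) _; rewrite /= -[RHS]compcA tilde_arrE !compcA.
by congr (_ \oc _); symmetry; apply: transpE.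
Qed.

End Kernel.

(* Enrichment in abelian groups; finite direct sums are the separate
   hypothesis [has_finite_direct_sums]. *)
Record additiveCategory := AdditiveCategory {
  aob : Type;
  ahom : aob -> aob -> zmodType;
  aid : forall A, ahom A A;
  acomp : forall A B C, ahom B C -> ahom A B -> ahom A C;
  acompA : forall A B C D (h : ahom C D) (g : ahom B C) (f : ahom A B),
    acomp (acomp h g) f = acomp h (acomp g f);
  acomp1l : forall A B (f : ahom A B), acomp (aid B) f = f;
  acomp1r : forall A B (f : ahom A B), acomp f (aid A) = f;
  acompDl : forall A B C (g g' : ahom B C) (f : ahom A B),
    acomp (g + g')%R f = (acomp g f + acomp g' f)%R;
  acompDr : forall A B C (g : ahom B C) (f f' : ahom A B),
    acomp g (f + f')%R = (acomp g f + acomp g f')%R }.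

Definition acat (X : additiveCategory) : category :=
  @Category (aob X) (fun A B => ahom A B) (@aid X) (@acomp X)
    (@acompA X) (@acomp1l X) (@acomp1r X).

Lemma acomp0l (X : additiveCategory) (A B C : aob X) (f : ahom A B) :
  acomp (0 : ahom B C)%R f = 0%R.
Proof.
by apply: (addrI (acomp (0 : ahom B C)%R f)); rewrite -acompDl !addr0.
Qed.

Lemma acomp0r (X : additiveCategory) (A B C : aob X) (f : ahom B C) :
  acomp f (0 : ahom A B)%R = 0%R.
Proof.
by apply: (addrI (acomp f (0 : ahom A B)%R)); rewrite -acompDr !addr0.
Qed.

Definition aptcat (X : additiveCategory) : ptCategory :=
  @PtCategory (acat X) (fun A B => 0%R : ahom A B)
    (fun A B C f => acomp0l C f) (fun A B C f => acomp0r A f).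

Coercion aptcat : additiveCategory >-> ptCategory.

Definition idempotents_split (X : additiveCategory) : Prop :=
  forall (A : X) (e : hom A A), e \oc e = e ->
    exists (B : X) (i : hom B A) (p : hom A B),
      p \oc i = idc B /\ i \oc p = e.

Definition has_finite_direct_sums (X : additiveCategory) : Prop :=
  forall (n : nat) (A : 'I_n -> aob X),
    exists (S : aob X) (i : forall k, ahom (A k) S) (p : forall k, ahom S (A k)),
      [/\ forall k, acomp (p k) (i k) = aid (A k),
          forall j k, j != k -> acomp (p j) (i k) = 0%R
        & (\sum_(k < n) acomp (i k) (p k))%R = aid S].

(* Identities, hence all objects, belong to M because isomorphisms do. *)
Record subcategory (P : category) := Subcategory {
  inM : forall A B : P, hom A B -> Prop;
  inM_iso : forall (A B : P) (f : hom A B), is_iso f -> inM f;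
  inM_comp : forall (A B C : P) (g : hom B C) (f : hom A B),
    inM g -> inM f -> inM (g \oc f) }.

Record mor (P : category) (M : subcategory P) (A B : P) := Mor {
  mval :> hom A B;
  morP : inM M mval }.

Lemma iso_id (P : category) (A : P) : is_iso (idc A).
Proof. by exists (idc A); rewrite comp1c. Qed.

Lemma mor_eq (P : category) (M : subcategory P) (A B : P) (m n : mor M A B) :
  mval m = mval n -> m = n.
Proof.
case: m n => [m Mm] [n Mn] /= e.
by case: _ / e Mn => Mn; congr Mor; apply: Prop_irrelevance.
Qed.

Definition mor_id (P : category) (M : subcategory P) (A : P) : mor M A A :=
  Mor (inM_iso M (iso_id A)).

Definition mor_comp (P : category) (M : subcategory P) (A B C : P)
    (n : mor M B C) (m : mor M A B) : mor M A C :=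
  Mor (inM_comp (morP n) (morP m)).

(* [star] is the functor ( )^* : M^op -> P; that it is the identity on objects
   is built into its type. *)
Record dkData := DkData {
  dkP :> category;
  dkM : subcategory dkP;
  star : forall A B : dkP, mor dkM A B -> hom B A;
  star_id : forall A : dkP, star (mor_id dkM A) = idc A;
  star_comp : forall (A B C : dkP) (n : mor dkM B C) (m : mor dkM A B),
    star (mor_comp n m) = star m \oc star n;
  starK : forall (A B : dkP) (m : mor dkM A B), star m \oc m = idc A }.

Section DkDefinitions.
Variable P : dkData.
Notation mor := (mor (dkM P)).

Definition inR (A B : P) (r : hom A B) : Prop :=
  forall (A' B' : P) (m : mor B' B) (x : hom A' B') (n : mor A' A),
    r = m \oc x \oc star n -> is_iso m /\ is_iso n.

Definition inS (A B : P) (s : hom A B) : Prop :=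
  exists (A' : P) (r : hom A' B) (m : mor A' A), inR r /\ s = r \oc star m.

Record subobj (A : P) := Subobj {
  so_dom : P;
  so_mor : mor so_dom A }.

Definition so_isom (A : P) (m n : subobj A) : Prop :=
  exists f : hom (so_dom m) (so_dom n),
    is_iso f /\ mval (so_mor m) = so_mor n \oc f.

Definition so_class (A : P) (m : subobj A) : set (subobj A) :=
  [set n | so_isom m n].

Definition Sub (A : P) : Type :=
  {c : set (subobj A) | exists m : subobj A, c = so_class m}.

Definition Rrel (A : P) (c d : Sub A) : Prop :=
  exists m n : subobj A, [/\ sval c m, sval d n
    & inM (dkM P) (star (so_mor m) \oc so_mor n)].

Definition condA1 : Prop :=
  (forall (A B : P) (f : hom A B),
     exists (A' B' : P) (n : mor B' B) (r : hom A' B') (m : mor A' A),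
       inR r /\ f = n \oc r \oc star m) /\
  (forall (A B A1 B1 A2 B2 : P)
      (n1 : mor B1 B) (r1 : hom A1 B1) (m1 : mor A1 A)
      (n2 : mor B2 B) (r2 : hom A2 B2) (m2 : mor A2 A),
     inR r1 -> inR r2 ->
     n1 \oc r1 \oc star m1 = n2 \oc r2 \oc star m2 ->
     exists (a : hom A1 A2) (b : hom B1 B2),
       [/\ is_iso a, is_iso b, mval m1 = m2 \oc a, mval n1 = n2 \oc b
         & b \oc r1 = r2 \oc a]).

Definition condA2 : Prop :=
  forall (A B C : P) (r : hom A B) (r' : hom B C),
    inR r -> inR r' -> inS (r' \oc r).

Definition condA3 : Prop :=
  forall (A B C : P) (r : hom A B) (m : mor C B),
    inR r -> inR (star m \oc r) -> is_iso m.

Definition in_MMstar (A B : P) (f : hom A B) : Prop :=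
  exists (C : P) (m : mor C B) (n : mor C A), f = m \oc star n.

Definition condA4 : Prop :=
  forall (A B C : P) (g : hom B C) (f : hom A B),
    in_MMstar g -> in_MMstar f -> in_MMstar (g \oc f).

Definition condA5 : Prop := forall A : P, finite_set [set: Sub A].

Definition condA6 : Prop :=
  forall A : P, exists Q : Sub A -> Sub A -> Prop,
    [/\ forall c d, Rrel c d -> Q c d,
        forall c d, Q c d -> Q d c -> c = d
      & forall c d e, Q c d -> Q d e -> Q c e].

Record dkConditions : Prop := DkConditions {
  dkA1 : condA1;
  dkA2 : condA2;
  dkA3 : condA3;
  dkA4 : condA4;
  dkA5 : condA5;
  dkA6 : condA6 }.

Lemma mor_mono (A B C : P) (m : mor B C) (f g : hom A B) :
  m \oc f = m \oc g -> f = g.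
Proof.
by move=> e; rewrite -(comp1c f) -(comp1c g) -(starK m) !compcA e.
Qed.

Lemma star_iso (A B : P) (m : mor A B) : is_iso m -> is_iso (star m).
Proof.
move=> [g [_ mg]]; exists m; split; last exact: starK.
have -> : star m = g; last by [].
by rewrite -(compc1 (star m)) -mg -compcA starK comp1c.
Qed.

Lemma star_split_mono (A B : P) (m : mor A B) (g : hom A B) :
  g \oc star m = idc B -> is_iso m.
Proof.
move=> gm; exists (star m); split; first exact: starK.
suff -> : mval m = g by [].
by rewrite -(comp1c m) -gm compcA starK compc1.
Qed.

Lemma mor_split_epi (A B : P) (m : mor A B) (g : hom B A) :
  m \oc g = idc B -> is_iso m.
Proof.
move=> mg; exists g; split => //; apply: (@mor_mono _ _ _ m).
by rewrite -compcA mg comp1c compc1.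
Qed.

Lemma inR_id (A : P) : inR (idc A).
Proof.
move=> A' B' m x n e; split.
- by apply: (@mor_split_epi _ _ m (x \oc star n)); rewrite -compcA -e.
- by apply: (@star_split_mono _ _ n (m \oc x)); rewrite -e.
Qed.

Lemma iso_mor_compl (A B C : P) (m : mor B C) (n : mor A B) :
  is_iso (mor_comp m n) -> is_iso m.
Proof.
move=> [g [_ mng]]; apply: (@mor_split_epi _ _ m (n \oc g)).
by rewrite -compcA.
Qed.

Lemma inR_starr (A A' B : P) (x : hom A' B) (n : mor A' A) :
  inR (x \oc star n) -> is_iso n.
Proof.
by move=> /(_ A' B (mor_id _ B) x n) []; rewrite //= comp1c.
Qed.

Lemma inR_morl (A B' B : P) (m : mor B' B) (x : hom A B') :
  inR (m \oc x) -> is_iso m.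
Proof.
by move=> /(_ A B' m x (mor_id _ A)) []; rewrite // star_id compc1.
Qed.

Lemma is_iso_comp (C : category) (A B E : C) (g : hom B E) (f : hom A B) :
  is_iso g -> is_iso f -> is_iso (g \oc f).
Proof.
move=> [g' [g'g gg']] [f' [f'f ff']]; exists (f' \oc g'); split.
- by rewrite compcA -(compcA g') g'g comp1c.
- by rewrite compcA -(compcA f) ff' comp1c.
Qed.

Lemma inR_isor (A' A B : P) (r : hom A B) (f : hom A' A) :
  inR r -> is_iso f -> inR (r \oc f).
Proof.
move=> Rr isof A1 B1 m x n e.
have [g [gf fg]] := isof.
have isog : is_iso g by exists f.
have isoN : forall (f' : mor A' A), is_iso f' -> forall n0 : mor A1 A',
    is_iso (mor_comp f' n0) -> is_iso n0.
  move=> f' [h [hf fh]] n0 isofn /=.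
  have -> : mval n0 = h \oc (mor_comp f' n0) by rewrite /= -compcA hf comp1c.
  by apply: is_iso_comp => //; exists f'.
pose f' : mor A' A := Mor (inM_iso (dkM P) isof).
have e' : r = m \oc x \oc star (mor_comp f' n).
  rewrite star_comp -compcA -e compcA.
  suff -> : star f' = g by rewrite fg compc1.
  by rewrite -(compc1 (star f')) -fg -compcA (starK f') comp1c.
by have [im inn] := Rr _ _ _ _ _ e'; split => //; apply: (isoN f').
Qed.

(* p(Lambda) is [option], with base point [None]. *)
Definition pmk (T : Type) (Q : T -> Prop) (x : T) : option {x : T | Q x} :=
  match pselect (Q x) with
  | left h => Some (exist Q x h)
  | right _ => None
  end.

Lemma pmkT (T : Type) (Q : T -> Prop) (x : T) (h : Q x) :
  pmk Q x = Some (exist Q x h).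
Proof.
by rewrite /pmk; case: pselect => // h'; congr Some; apply: eq_exist.
Qed.

Lemma pmkF (T : Type) (Q : T -> Prop) (x : T) : ~ Q x -> pmk Q x = None.
Proof. by rewrite /pmk; case: pselect. Qed.

Hypothesis H : dkConditions.

Lemma inR_starl_iso (A B C D : P) (r : hom A B) (k : mor C B) (x : hom C D) :
  inR r -> inR (x \oc star k \oc r) -> is_iso k.
Proof.
move=> Rr Rx.
have [A' [B' [a [y [b [Ry e]]]]]] := (dkA1 H).1 _ _ (star k \oc r).
have isob : is_iso b.
  apply: (@inR_starr _ _ _ (x \oc (a \oc y))).
  by move: Rx; rewrite compcA e -!compcA.
have e' : star (mor_comp k a) \oc r = y \oc star b.
  by rewrite star_comp compcA e -!compcA starK comp1c.
apply: (@iso_mor_compl _ _ _ k a); apply: (dkA3 H Rr).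
by rewrite e'; apply: inR_isor => //; apply: star_iso.
Qed.

Definition dhom (A B : P) : Type := option {r : hom A B | inR r}.

Definition did (A : P) : dhom A A := Some (exist _ (idc A) (@inR_id A)).

Definition dcomp (A B C : P) (g : dhom B C) (f : dhom A B) : dhom A C :=
  match g, f with
  | Some r', Some r => pmk (@inR A C) (sval r' \oc sval r)
  | _, _ => None
  end.

Lemma inR_compl (A B C E : P) (r : hom A B) (s : hom B C) (t : hom C E) :
  inR r -> inR s -> inR t -> inR (t \oc s \oc r) -> inR (t \oc s).
Proof.
move=> Rr Rs Rt Rtsr.
have [A' [q [m [Rq e]]]] := dkA2 H Rs Rt.
rewrite e in Rtsr *.
by apply: inR_isor => //; apply: star_iso; apply: inR_starl_iso Rtsr.
Qed.

Lemma inR_compr (A B C E : P) (r : hom A B) (s : hom B C) (t : hom C E) :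
  inR r -> inR s -> inR (t \oc s \oc r) -> inR (s \oc r).
Proof.
move=> Rr Rs Rtsr.
have [A' [q [m [Rq e]]]] := dkA2 H Rr Rs.
rewrite compcA e in Rtsr *.
apply: inR_isor => //; apply: star_iso; apply: (@inR_starr _ _ _ (t \oc q)).
by rewrite compcA.
Qed.

Lemma dcompA (A B C E : P) (h : dhom C E) (g : dhom B C) (f : dhom A B) :
  dcomp (dcomp h g) f = dcomp h (dcomp g f).
Proof.
case: h g f => [[t Rt]|] [[s Rs]|] [[r Rr]|] //=; last by case: pmk.
have [Rts|nRts] := pselect (inR (t \oc s));
  have [Rsr|nRsr] := pselect (inR (s \oc r)).
- by rewrite (pmkT Rts) (pmkT Rsr) /= compcA.
- rewrite (pmkT Rts) (pmkF nRsr) /= pmkF // => Rtsr.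
  by apply: nRsr; apply: inR_compr Rtsr.
- rewrite (pmkF nRts) (pmkT Rsr) /= pmkF // -compcA => Rtsr.
  by apply: nRts; apply: inR_compl Rtsr.
- by rewrite (pmkF nRts) (pmkF nRsr).
Qed.

Lemma dcomp1l (A B : P) (f : dhom A B) : dcomp (did B) f = f.
Proof. by case: f => [[r Rr]|] //=; rewrite comp1c (pmkT Rr). Qed.

Lemma dcomp1r (A B : P) (f : dhom A B) : dcomp f (did A) = f.
Proof. by case: f => [[r Rr]|] //=; rewrite compc1 (pmkT Rr). Qed.

Program Definition dkD : ptCategory :=
  @PtCategory (@Category P dhom did dcomp dcompA dcomp1l dcomp1r)
    (fun A B => None) _ _.
Next Obligation. by []. Qed.
Next Obligation. by move=> A B C [[]|]. Qed.

Record sm_fact (A B : P) (u : hom A B) := SmFact {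
  sm_ob : P;
  sm_s : hom A sm_ob;
  sm_m : mor sm_ob B;
  sm_sS : inS sm_s;
  sm_E : u = sm_m \oc sm_s }.

Lemma sm_fact_ex (A B : P) (u : hom A B) : exists _ : sm_fact u, True.
Proof.
have [A' [B' [n [r [m [Rr e]]]]]] := (dkA1 H).1 _ _ u.
have Ss : inS (r \oc star m) by exists A', r, m.
by exists (SmFact Ss (etrans e (compcA _ _ _))).
Qed.

(* A choice of u = m_u \oc s_u; by (A1) it is unique up to isomorphism, so
   whether s_u lies in R does not depend on the choice (see [inMRP]). *)
Definition factS (A B : P) (u : hom A B) : sm_fact u :=
  sval (cid (sm_fact_ex u)).

Definition s_of (A B : P) (u : hom A B) : hom A (sm_ob (factS u)) :=
  sm_s (factS u).

Definition inMR (A B : P) (u : hom A B) : Prop := inR (s_of u).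

Lemma inMRP (A B : P) (u : hom A B) :
  inMR u <->
  forall (A' : P) (x : hom A' B) (k : mor A' A), u = x \oc star k -> is_iso k.
Proof.
rewrite /inMR /s_of; split=> [Ru A' x k e|Ku].
- apply: (@inR_starr _ _ _ (star (sm_m (factS u)) \oc x)).
  by rewrite compcA -e [X in _ \oc X](sm_E (factS u)) -compcA starK comp1c.
- have [A' [r [k [Rr e]]]] := sm_sS (factS u).
  rewrite e; apply: inR_isor => //; apply: star_iso.
  apply: (Ku _ (sm_m (factS u) \oc r)).
  by rewrite compcA -e -sm_E.
Qed.

Lemma inMR_inR (A B : P) (r : hom A B) : inR r -> inMR r.
Proof. by move=> Rr; apply/inMRP => A' x k e; apply: (@inR_starr _ _ _ x); rewrite -e. Qed.

Lemma inMR_compl (A B C : P) (f : hom B C) (u : hom A B) :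
  inMR (f \oc u) -> inMR u.
Proof.
move=> /inMRP Ku; apply/inMRP => A' x k e.
by apply: (Ku _ (f \oc x)); rewrite e compcA.
Qed.

Lemma inMR_compr (A B C : P) (u : hom B C) (r : hom A B) :
  inR r -> inMR (u \oc r) -> inMR u.
Proof.
move=> Rr MRur; apply/inMRP => A' x k e.
rewrite /inMR in MRur; set s := s_of (u \oc r) in MRur.
have es : s = star (sm_m (factS (u \oc r))) \oc x \oc star k \oc r.
  rewrite (_ : _ \oc r = star (sm_m (factS (u \oc r))) \oc (u \oc r)).
    rewrite -[LHS]comp1c -(starK (sm_m (factS (u \oc r)))) compcA.
    by congr (_ \oc _); rewrite -sm_E.
  by rewrite e !compcA.
by rewrite es in MRur; apply: inR_starl_iso MRur.
Qed.

Definition Mob (X : prodc (opc dkD) P) : Type :=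
  option {u : @hom P X.1 X.2 | inMR u}.

Definition Mmap (X Y : prodc (opc dkD) P) (rf : hom X Y) (w : Mob X) : Mob Y :=
  match rf.1 : dhom Y.1 X.1, w with
  | Some r, Some u => pmk (@inMR Y.1 Y.2) (rf.2 \oc sval u \oc sval r)
  | _, _ => None
  end.

Lemma Mmap_pt (X Y : prodc (opc dkD) P) (rf : hom X Y) : Mmap rf None = None.
Proof. by rewrite /Mmap; case: rf.1. Qed.

Lemma Mmap1 (X : prodc (opc dkD) P) (w : Mob X) : Mmap (idc X) w = w.
Proof.
by case: w => [[u MRu]|] //; rewrite /Mmap /= comp1c compc1 (pmkT MRu).
Qed.

Lemma MmapM (X Y Z : prodc (opc dkD) P) (g : hom Y Z) (f : hom X Y) (w : Mob X) :
  Mmap (g \oc f) w = Mmap g (Mmap f w).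
Proof.
case: X Y Z g f w => [A B] [A1 B1] [A2 B2] [/= r' f'] [/= r f] w.
case: w => [[u MRu]|]; last by rewrite !Mmap_pt.
rewrite {1 3}/Mmap /=; case: r => [[r Rr]|] /=; last by rewrite Mmap_pt.
case: r' => [[r' Rr']|] /=; last by rewrite /Mmap.
have [MR1|nMR1] := pselect (inMR (f \oc u \oc r)).
- rewrite (pmkT MR1) /Mmap /=.
  have e : f' \oc (f \oc u \oc r) \oc r' = f' \oc f \oc u \oc (r \oc r').
    by rewrite !compcA.
  have [Rrr|nRrr] := pselect (inR (r \oc r')).
    by rewrite (pmkT Rrr) /= e.
  rewrite (pmkF nRrr) pmkF // e => MR2; apply: nRrr.
  have [A' [q [k [Rq eq]]]] := dkA2 H Rr' Rr.
  rewrite eq; apply: inR_isor => //; apply: star_iso.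
  by move/inMRP: MR2; apply; rewrite eq -compcA.
- rewrite (pmkF nMR1) Mmap_pt.
  case: (pselect (inR (r \oc r'))) => [Rrr|nRrr]; last by rewrite (pmkF nRrr).
  rewrite (pmkT Rrr) /= pmkF // => MR2; apply: nMR1.
  apply: (inMR_compl (f := f')); apply: (inMR_compr Rr').
  by move: MR2; rewrite !compcA.
Qed.

Program Definition dkKernel : kernel dkD P :=
  @Kernel dkD P (@PsFunctor _ Mob (fun X => None) Mmap Mmap_pt Mmap1 MmapM) _.
Next Obligation. by []. Qed.

End DkDefinitions.

(* Main.v *)
From HB Require Import structures.
From mathcomp Require Import all_boot all_algebra.
From mathcomp Require Import boolp classical_sets cardinality.
Require Import Defs.

(* Write [hat F B] as the direct sum of the F S over the subobjects S of B, and
   [tilde T A] as the joint kernel of the T(star k) over the proper subobjects k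
   of A. By (A4), star m \oc n = a \oc star b for m, n in M; hence a vector
   killed by proper stars is killed by star m \oc n unless this morphism lies in
   M, which by (A6) is a strict order relation between m and n when m and n
   differ. All the linear systems met below are therefore unitriangular over
   the finite set Sub A: this yields the idempotent of T A that splits to
   [tilde T A], shows that a vector of [hat F A] killed by all proper stars lies
   in the top summand F A, so that the unit is invertible, and shows that the
   counit is a monomorphism; the complement of the idempotent, which factors
   through proper subobjects, provides by induction a section of the counit. *)

Set Implicit Arguments.
Unset Strict Implicit.
Unset Printing Implicit Defensive.

Import GRing.Theory.
Local Open Scope ring_scope.

#[local] Arguments compc : simpl never.

(** * Sums of morphisms in an additive category *)

HB.instance Definition _ (X : additiveCategory) (A B : X) :=
  GRing.Zmodule.copy (@hom X A B) (ahom A B).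

Section AdditiveHoms.
Variable X : additiveCategory.
Implicit Types A B C : X.

Lemma compcDl A B C (g g' : hom B C) (f : hom A B) :
  (g + g') \oc f = (g \oc f) + (g' \oc f).
Proof. exact: acompDl. Qed.

Lemma compcDr A B C (g : hom B C) (f f' : hom A B) :
  g \oc (f + f') = (g \oc f) + (g \oc f').
Proof. exact: acompDr. Qed.

Lemma compc0l A B C (f : hom A B) : (0 : hom B C) \oc f = 0.
Proof. exact: acomp0l. Qed.

Lemma compc0r A B C (g : hom B C) : g \oc (0 : hom A B) = 0.
Proof. exact: acomp0r. Qed.

Lemma compcBl A B C (g g' : hom B C) (f : hom A B) :
  (g - g') \oc f = (g \oc f) - (g' \oc f).
Proof. by apply: (addIr (g' \oc f)); rewrite -compcDl !subrK. Qed.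

Lemma compcBr A B C (g : hom B C) (f f' : hom A B) :
  g \oc (f - f') = (g \oc f) - (g \oc f').
Proof. by apply: (addIr (g \oc f')); rewrite -compcDr !subrK. Qed.

Lemma compc_suml A B C (I : Type) (r : seq I) (Q : pred I)
    (g : I -> hom B C) (f : hom A B) :
  (\sum_(i <- r | Q i) g i) \oc f = \sum_(i <- r | Q i) (g i \oc f).
Proof.
by apply: (big_morph (fun g => g \oc f)) => [x y|];
  [apply: compcDl|apply: compc0l].
Qed.

Lemma compc_sumr A B C (I : Type) (r : seq I) (Q : pred I)
    (g : hom B C) (f : I -> hom A B) :
  g \oc (\sum_(i <- r | Q i) f i) = \sum_(i <- r | Q i) (g \oc f i).
Proof.
by apply: (big_morph (fun f => g \oc f)) => [x y|];
  [apply: compcDr|apply: compc0r].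
Qed.

Lemma ptfunctor0 (D : ptCategory) (F : ptFunctor D X) (A B : D) :
  fmap F (zeroc A B) = 0.
Proof. exact: fmap0. Qed.

Lemma direct_sum (Xsum : has_finite_direct_sums X) (n : nat) (A : 'I_n -> X) :
  exists (S : X) (i : forall k, hom (A k) S) (p : forall k, hom S (A k)),
    [/\ forall k, p k \oc i k = idc (A k),
        forall j k, j != k -> p j \oc i k = 0
      & \sum_(k < n) (i k \oc p k) = idc S].
Proof. exact: Xsum. Qed.

(** A section g gives f (g f - 1) = 0, and f cancels on the left. *)
Lemma mono_split_epi_iso A B (f : hom A B) :
  (forall (Z : X) (x : hom Z A), f \oc x = 0 -> x = 0) ->
  (exists g : hom B A, f \oc g = idc B) -> is_iso f.
Proof.
move=> fmono [g fg]; exists g; split => //.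
by apply/subr0_eq/fmono; rewrite compcBr -compcA fg comp1c compc1 subrr.
Qed.

Lemma factor_sum (L Y Z : X) (h : hom L Z) (n : nat) (Q : pred 'I_n)
    (f : 'I_n -> hom Y Z) :
  (forall j, Q j -> exists w : hom Y L, f j = h \oc w) ->
  exists w : hom Y L, \sum_(j | Q j) f j = h \oc w.
Proof.
move=> Hf; elim/big_ind : _ => [|x y [w ->] [w' ->]|j /Hf //].
- by exists 0; rewrite compc0r.
- by exists (w + w'); rewrite compcDr.
Qed.

End AdditiveHoms.

(** * Subobjects, elements of the kernel, and the ranking of Sub A *)

Section Subobjects.
Variable P : dkData.
Notation mor := (mor (dkM P)).

Lemma so_isom_refl (A : P) (m : subobj A) : so_isom m m.
Proof. by exists (idc _); split; [exact: iso_id|rewrite compc1]. Qed.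

Lemma so_isom_sym (A : P) (m n : subobj A) : so_isom m n -> so_isom n m.
Proof.
move=> [f [[g [gf fg]] e]]; exists g; split; first by exists f.
by rewrite e compcA fg compc1.
Qed.

Lemma so_isom_trans (A : P) (m n k : subobj A) :
  so_isom m n -> so_isom n k -> so_isom m k.
Proof.
move=> [f [isof e]] [g [isog e']]; exists (g \oc f); split.
  exact: is_iso_comp.
by rewrite e e' -compcA.
Qed.

Lemma so_class_eqP (A : P) (m n : subobj A) :
  so_class m = so_class n <-> so_isom m n.
Proof.
split=> [e|mn].
  by change (so_class m n); rewrite e; apply: so_isom_refl.
rewrite predeqE => k; split => [mk|nk].
  exact: so_isom_trans (so_isom_sym mn) mk.
exact: so_isom_trans mn nk.
Qed.

Lemma star_isom (A : P) (m n : subobj A) : so_isom m n ->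
  exists2 g : hom (so_dom n) (so_dom m),
    is_iso g & star (so_mor m) = g \oc star (so_mor n).
Proof.
move=> [f [isof e]]; pose f' : mor _ _ := Mor (inM_iso (dkM P) isof).
exists (star f'); first exact: star_iso.
by rewrite -star_comp; congr star; apply: mor_eq.
Qed.

Lemma inR_isol (A B C : P) (r : hom A B) (f : hom B C) :
  inR r -> is_iso f -> inR (f \oc r).
Proof.
move=> Rr isof A1 B1 m x n e.
have [g [gf fg]] := isof.
have isog : is_iso g by exists f.
have e' : r = mor_comp (Mor (inM_iso (dkM P) isog)) m \oc x \oc star n.
  by rewrite /= -[LHS]comp1c -gf !compcA e !compcA.
have [im inn] := Rr _ _ _ _ _ e'; split => //.
suff -> : mval m = f \oc (g \oc m) by apply: is_iso_comp.
by rewrite -compcA fg comp1c.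
Qed.

Hypothesis H : dkConditions P.

Lemma inMR_mor (A S B : P) (m : mor S B) (r : hom A S) :
  inR r -> inMR H (m \oc r).
Proof.
move=> Rr; apply/inMRP => A' x k e; apply: (@inR_starr _ _ _ _ (star m \oc x)).
by rewrite compcA -e -compcA starK comp1c.
Qed.

Lemma inMR_id (A : P) : inMR H (idc A).
Proof. exact/inMR_inR/inR_id. Qed.

Lemma inMR_morE (S B : P) (m : mor S B) : inMR H m.
Proof. by rewrite -[mval m]compc1; apply: inMR_mor; apply: inR_id. Qed.

Lemma inMR_decomp (A B : P) (u : hom A B) : inMR H u ->
  exists (S : P) (m : mor S B) (r : hom A S), inR r /\ u = m \oc r.
Proof.
move=> Ru; exists (sm_ob (factS H u)), (sm_m (factS H u)), (s_of H u).
by split => //; apply: sm_E.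
Qed.

Lemma not_inMR (A B : P) (u : hom A B) : ~ inMR H u ->
  exists (A' : P) (x : hom A' B) (k : mor A' A), u = x \oc star k /\ ~ is_iso k.
Proof.
move=> nu; apply: contrapT => nx; apply: nu; apply/inMRP => A' x k e.
by apply: contrapT => nk; apply: nx; exists A', x, k.
Qed.

(** By (A2), v r = q star(k) with q in R; as m v r is in the kernel, k is invertible. *)
Lemma inMR_comp_inR (A1 A B S : P) (m : mor S B) (v : hom A S) (r : hom A1 A) :
  inR r -> inR v -> inMR H (m \oc v \oc r) -> inR (v \oc r).
Proof.
move=> Rr Rv; have [A' [q [k [Rq e]]]] := dkA2 H Rr Rv.
rewrite compcA e => /inMRP Hk; apply: inR_isor => //.
by apply/star_iso/(Hk _ (m \oc q)); rewrite -compcA.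
Qed.

Lemma MR_uniq (A B S S' : P) (m : mor S B) (m' : mor S' B)
    (r : hom A S) (r' : hom A S') :
  inR r -> inR r' -> m \oc r = m' \oc r' ->
  exists2 b : hom S S', is_iso b & mval m = m' \oc b /\ b \oc r = r'.
Proof.
move=> Rr Rr' e.
have e' : m \oc r \oc star (mor_id _ A) = m' \oc r' \oc star (mor_id _ A).
  by rewrite e.
have [a [b [_ isob]]] := (dkA1 H).2 _ _ _ _ _ _ _ _ _ _ _ _ Rr Rr' e'.
move=> _ emb _; exists b => //; split=> //.
by apply: (@mor_mono _ _ _ _ m'); rewrite -compcA -emb.
Qed.

Lemma star_mor_factor (A U V : P) (m : mor U A) (n : mor V A) :
  exists (C : P) (a : mor C U) (b : mor C V), star m \oc n = a \oc star b.
Proof.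
apply: (dkA4 H).
  by exists U, (mor_id _ U), m; rewrite comp1c.
by exists V, n, (mor_id _ V); rewrite star_id compc1.
Qed.

(** In the form a star(b) given by (A4), membership in the kernel makes b invertible. *)
Lemma star_mor_MR (A U V : P) (m : mor U A) (n : mor V A) :
  inMR H (star m \oc n) -> inM (dkM P) (star m \oc n).
Proof.
have [C [a [b e]]] := star_mor_factor m n.
move=> /inMRP /(_ _ _ _ e) isob; rewrite e; apply: inM_comp; first exact: morP.
by apply/inM_iso/star_iso.
Qed.

(* The rank is strictly decreasing for the relation of (A6), so that the top
   subobject gets the largest one. *)
Record subobj_ranking (A : P) := SubobjRanking {
  sr_n : nat;
  sr_rep : 'I_sr_n -> subobj A;
  sr_rank : 'I_sr_n -> nat;
  sr_top : 'I_sr_n;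
  sr_topE : sr_rep sr_top = Subobj (mor_id (dkM P) A);
  sr_full : forall m : subobj A, exists i, so_isom m (sr_rep i);
  sr_inj : forall i j, so_isom (sr_rep i) (sr_rep j) -> i = j;
  sr_rankP : forall i j,
    inM (dkM P) (star (so_mor (sr_rep i)) \oc so_mor (sr_rep j)) ->
    i != j -> (sr_rank j < sr_rank i)%N }.

(** Sub A is finite by (A5). With Q the relation of (A6), the rank of i is the number of j that
    equal i or satisfy i Q j. If i Q j and i, j differ, transitivity includes the set of j in that
    of i, and antisymmetry keeps i out of the former. *)
Lemma subobj_ranking_exists (A : P) : exists _ : subobj_ranking A, True.
Proof.
have [n /card_set_bijP[f [ffun finj fsurj]]] := dkA5 H A.
pose top := Subobj (mor_id (dkM P) A).
(* The top class is represented by the identity itself, so that [sr_topE] is an equality. *)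
pose rep (c : Sub A) :=
  if pselect (sval c = so_class top) then top else sval (cid (svalP c)).
have repE c : sval c = so_class (rep c).
  by rewrite /rep; case: pselect => //= _; exact: (svalP (cid (svalP c))).
have repI c d : so_isom (rep c) (rep d) -> c = d.
  move=> /so_class_eqP; rewrite -!repE; move: c d => [c hc] [d hd] /=.
  exact: eq_exist.
have g_ex (i : 'I_n) : exists c : Sub A, f c = i.
  by have [|c _ <-] := fsurj i; [exact: ltn_ord|exists c].
pose g i := sval (cid (g_ex i)).
have fg i : f (g i) = i by rewrite /g; case: cid.
have cls (m : subobj A) : exists i : 'I_n, so_class m = sval (g i).
  pose c : Sub A := exist _ (so_class m) (ex_intro _ m erefl).
  have lt_fc : (f c < n)%N by exact: (ffun c I).
  exists (Ordinal lt_fc); rewrite (_ : g _ = c) //.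
  by apply: finj; rewrite ?inE ?fg.
have [i0 Hi0] := cls top.
have [Q [RQ Qanti Qtrans]] := dkA6 H A.
pose up (i : 'I_n) := [pred j : 'I_n | (j == i) || `[< Q (g i) (g j) >]].
have gI i j : g i = g j -> i = j.
  by move=> e; apply: val_inj; rewrite /= -fg e fg.
unshelve refine (ex_intro _
  (@SubobjRanking A n (rep \o g) (fun i => #|up i|) i0 _ _ _ _) I).
- by rewrite /= /rep; case: pselect => // ntop; case: ntop; rewrite -Hi0.
- move=> m; have [i Hi] := cls m; exists i.
  by apply/so_class_eqP; rewrite /= Hi repE.
- by move=> i j /= /repI; apply: gI.
- move=> i j Mij nij; have Qij : Q (g i) (g j).
    apply: RQ; exists (rep (g i)), (rep (g j)).
    by rewrite !repE; split => //; apply: so_isom_refl.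
  apply: proper_card; apply/properP; split.
    apply/fintype.subsetP => k; rewrite !inE => /orP[/eqP ->|/asboolP Qjk].
      by apply/orP; right; apply/asboolP.
    by apply/orP; right; apply/asboolP; apply: Qtrans Qij Qjk.
  exists i; rewrite !inE ?eqxx // negb_or nij /=.
  apply/asboolP => Qji; move/eqP: nij; apply; exact/gI/Qanti.
Qed.

Section Ranking.
Variables (A : P) (R : subobj_ranking A).
Implicit Types i j : 'I_(sr_n R).
Local Notation s i := (so_mor (sr_rep i)).

Lemma sr_iso_top i : is_iso (s i) -> i = sr_top R.
Proof.
move=> isoi; apply: sr_inj; rewrite sr_topE; exists (s i).
by split; rewrite //= comp1c.
Qed.

Lemma sr_rank_top i : i != sr_top R -> (sr_rank i < sr_rank (sr_top R))%N.
Proof.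
rewrite eq_sym => ni; apply: sr_rankP ni; rewrite sr_topE /= star_id comp1c.
exact: morP.
Qed.

Lemma sr_proper (C : P) (k : mor C A) : ~ is_iso k ->
  exists2 i : 'I_(sr_n R), i != sr_top R & so_isom (Subobj k) (sr_rep i).
Proof.
move=> nk; have [i ki] := sr_full R (Subobj k); exists i => //.
apply/eqP => it; apply: nk; have [f [isof /= ->]] := ki.
by move: f isof {ki}; rewrite it sr_topE /= => f; rewrite comp1c.
Qed.

(** Such a composite is sent by a functor to a morphism vanishing on vectors killed by proper
    stars. *)
Lemma sr_incompat i j : ~ inM (dkM P) (star (s i) \oc s j) ->
  exists (C : P) (a : hom C (so_dom (sr_rep i)))
         (b : mor C (so_dom (sr_rep j))),
    star (s i) \oc s j = a \oc star b /\ ~ is_iso b.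
Proof.
by move=> nM; apply: not_inMR => MRij; apply/nM/star_mor_MR.
Qed.

(** Up to isomorphism star(s j) (s l) is b, hence in M; and l = j would make b invertible. *)
Lemma sr_below j (C : P) (b : mor C (so_dom (sr_rep j))) : ~ is_iso b ->
  exists2 l : 'I_(sr_n R), so_isom (Subobj (mor_comp (s j) b)) (sr_rep l)
           & (sr_rank l < sr_rank j)%N.
Proof.
move=> nb; have [l bl] := sr_full R (Subobj (mor_comp (s j) b)).
exists l => //; apply: sr_rankP.
  have [g [[g' [g'g gg']] /= ->]] := so_isom_sym bl.
  rewrite -!compcA starK comp1c; apply: inM_comp; first exact: morP.
  by apply: inM_iso; exists g'.
apply/eqP => jl; apply: nb; move: bl; rewrite -jl => -[f [isof /= e]].
by rewrite (_ : mval b = f) //; apply: mor_mono e.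
Qed.

End Ranking.

End Subobjects.

(** * Joint kernels of proper stars and the limits defining $\widetilde M$ *)

Section Kernels.
Variables (P : dkData) (H : dkConditions P) (X : additiveCategory).
Variable T : functor P X.
Notation mor := (mor (dkM P)).

(** These are the generalised elements of the joint kernel $\widetilde M(T)A$, which need not be
    constructed to speak of them. *)
Definition killed (A : P) (Z : X) (x : hom Z (T A)) : Prop :=
  forall (C : P) (k : mor C A), ~ is_iso k -> fmap T (star k) \oc x = 0.

Lemma star_isom0 (A : P) (m n : subobj A) (Z : X) (x : hom Z (T A)) :
  so_isom m n -> fmap T (star (so_mor n)) \oc x = 0 ->
  fmap T (star (so_mor m)) \oc x = 0.
Proof.
by move=> /star_isom[g _ ->] x0; rewrite fmapM compcA x0 compc0r.
Qed.

Lemma killed_comp (A : P) (Z Z' : X) (x : hom Z (T A)) (y : hom Z' Z) :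
  killed x -> killed (x \oc y).
Proof. by move=> kx C k nk; rewrite -compcA kx // compc0l. Qed.

(* The idempotent is the product, ordered by n, of the factors
   [1 - \sum_m T(m \oc star m)] with m ranging over the proper subobjects of
   rank n: by (A4) and (A6), each factor preserves what those of smaller rank
   have achieved. *)
Lemma kernel_idempotent (A : P) : exists q : hom (T A) (T A),
  [/\ killed q,
      forall (Z : X) (x : hom Z (T A)), killed x -> q \oc x = x
    & forall (Y L : X) (t : hom (T A) Y) (h : hom L Y),
        (forall (C : P) (k : mor C A), ~ is_iso k ->
           exists w : hom (T C) L, t \oc fmap T k = h \oc w) ->
        exists w : hom (T A) L, t \oc (idc (T A) - q) = h \oc w].
Proof.
have [R _] := subobj_ranking_exists H A.
pose s (i : 'I_(sr_n R)) := so_mor (sr_rep i).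
suff step n : (n <= sr_rank (sr_top R))%N -> exists q : hom (T A) (T A),
  [/\ forall i, (sr_rank i < n)%N -> fmap T (star (s i)) \oc q = 0,
      forall (Z : X) (x : hom Z (T A)), killed x -> q \oc x = x
    & forall (Y L : X) (t : hom (T A) Y) (h : hom L Y),
        (forall (C : P) (k : mor C A), ~ is_iso k ->
           exists w : hom (T C) L, t \oc fmap T k = h \oc w) ->
        exists w : hom (T A) L, t \oc (idc (T A) - q) = h \oc w].
  have [q [q0 qx qh]] := step _ (leqnn _); exists q; split => // C k nk.
  have [i itop ki] := sr_proper R nk.
  by apply: (star_isom0 (m := Subobj k) ki); apply/q0/sr_rank_top.
elim: n => [|n IHn] ltn.
  exists (idc _); split=> // [Z x _|Y L t h _]; first by rewrite comp1c.
  by exists 0; rewrite subrr !compc0r.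
(* The bound on n keeps the top subobject out of every factor. *)
have niso j : sr_rank j = n -> ~ is_iso (s j).
  by move=> jn /sr_iso_top jt; rewrite -jt jn ltnn in ltn.
have [q [q0 qx qh]] := IHn (ltnW ltn).
pose e := \sum_(j | sr_rank j == n)
  (fmap T (s j) \oc (fmap T (star (s j)) \oc q)).
exists (q - e); split.
- move=> i; rewrite ltnS compcBr => lein.
  (* Here star(s i) (s j) = a star(b) with b proper, and s j b has rank below n, so its star already
     kills q. *)
  have ij0 j : sr_rank j = n -> i != j ->
      fmap T (star (s i))
        \oc (fmap T (s j) \oc (fmap T (star (s j)) \oc q)) = 0.
    move=> jn ij; rewrite -!compcA -fmapM.
    have [|C [a [b [-> nb]]]] := @sr_incompat _ H _ R i j.
      by move=> /sr_rankP /(_ ij); rewrite jn ltnNge lein.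
    have [l bl ltlj] := sr_below nb.
    rewrite -fmapM compcA -star_comp fmapM compcA.
    by rewrite (star_isom0 bl) ?compc0r //; apply: q0; rewrite -jn.
  rewrite /e compc_sumr; have [ein|nein] := eqVneq (sr_rank i) n.
    rewrite (big_only1 i) ?ein // => [|j ji /eqP jn].
      by rewrite -compcA -fmapM starK fmap1 comp1c subrr.
    by apply: ij0; rewrite // eq_sym.
  rewrite q0 ?ltn_neqAle ?nein // big1 ?subrr // => j /eqP jn.
  by apply: ij0 => //; apply: contraNneq nein => ->; apply/eqP.
- move=> Z x kx; rewrite compcBl qx // /e compc_suml big1 ?subr0 //.
  move=> j /eqP jn.
  by rewrite !compcA qx // kx ?compc0r //; apply: niso.
(* Since 1 - (q - e) = (1 - q) + e, only the terms of e are new, and each passes through a proper s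
   j. *)
- move=> Y L t h ht; rewrite opprB addrCA addrC compcDr compc_sumr.
  have [w ->] := qh Y L t h ht.
  have [|w' ->] := @factor_sum _ _ _ _ h _ (fun j => sr_rank j == n)
    (fun j => t \oc (fmap T (s j) \oc (fmap T (star (s j)) \oc q))).
    move=> j /eqP /niso /ht [v tv]; exists (v \oc (fmap T (star (s j)) \oc q)).
    by rewrite -!compcA tv.
  by exists (w + w'); rewrite compcDr.
Qed.

Local Notation K := (dkKernel H).

(** As in the Yoneda lemma, a cone is determined by its leg at this element. *)
Definition univ_elt (A : P) : krow K A A :=
  Some (exist _ (idc A) (@inMR_id P H A)).

Lemma psmap_univ_elt (A B : P) (u : hom A B) (hu : inMR H u) :
  psmap (krow K A) u (univ_elt A) = Some (exist _ u hu).
Proof. by rewrite /= /kact /= /Mmap /= !compc1 (pmkT hu). Qed.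

Section Cone.
Variables (A : P) (c : wcone (krow K A) T).
Let iota := cn_leg c (univ_elt A).

Lemma cone_legE (B : P) (u : hom A B) (hu : inMR H u) :
  @cn_leg _ _ _ _ c B (Some (exist _ u hu)) = fmap T u \oc iota.
Proof. by rewrite -cn_leg_nat psmap_univ_elt. Qed.

(** For k proper, star(k) is outside the kernel, so it sends the universal element to the base
    point, where legs vanish. *)
Lemma cone_killed : killed iota.
Proof.
move=> C k nk; rewrite -cn_leg_nat.
have -> : psmap (krow K A) (star k) (univ_elt A) = pspt _ C.
  rewrite /= /kact /= /Mmap /= !compc1 pmkF // => /inMRP /(_ _ (idc C) k).
  by rewrite comp1c => /(_ erefl).
exact: cn_leg_pt.
Qed.
End Cone.

Lemma killed_cone_pt (A B : P) (Z : X) (x : hom Z (T A)) (u : hom A B) :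
  killed x -> ~ inMR H u -> fmap T u \oc x = 0.
Proof.
move=> kx /not_inMR[C [y [k [-> nk]]]].
by rewrite fmapM compcA kx // compc0r.
Qed.

Section KilledCone.
Variables (A : P) (Z : X) (x : hom Z (T A)).
Hypothesis kx : killed x.

Definition killed_leg (B : P) (w : krow K A B) : hom Z (T B) :=
  if w is Some u then fmap T (sval u) \oc x else 0.

Lemma killed_leg_nat (B B1 : P) (f : hom B B1) (w : krow K A B) :
  killed_leg (psmap (krow K A) f w) = fmap T f \oc killed_leg w.
Proof.
case: w => [[u hu]|]; last by rewrite /= compc0r.
rewrite /= /kact /= /Mmap /= compc1 -compcA -fmapM.
have [hfu|nfu] := pselect (inMR H (f \oc u)); first by rewrite (pmkT hfu).
by rewrite (pmkF nfu) /= killed_cone_pt.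
Qed.

Definition killed_cone : wcone (krow K A) T :=
  @WCone _ _ (krow K A) T Z killed_leg (fun B => erefl) killed_leg_nat.
End KilledCone.

Lemma killed_cone_id (A : P) (Z : X) (x : hom Z (T A)) (kx : killed x) :
  cn_leg (killed_cone kx) (univ_elt A) = x.
Proof. by rewrite /= fmap1 comp1c. Qed.

(** Cones correspond to killed morphisms into T A, which are exactly those fixed by q; the splitting
    of q represents them. *)
Lemma wlimit_exists (Xsplit : idempotents_split X) (A : P) :
  exists c : wcone (krow K A) T, is_wlimit c.
Proof.
have [q [kq qx _]] := kernel_idempotent A.
have [L [i [p [pi ip]]]] := Xsplit _ q (qx _ _ kq).
have ki : killed i.
  by rewrite -[i]compc1 -pi -compcA ip; apply: killed_comp.
exists (killed_cone ki) => c'.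
have kx := cone_killed c'; set x := cn_leg c' (univ_elt A) in kx.
have ix : i \oc (p \oc x) = x by rewrite -compcA ip qx.
exists (p \oc x); split=> [B [[u hu]|]|h hh].
- by rewrite cone_legE killed_cone_id cone_legE compcA ix.
- by rewrite (cn_leg_pt (killed_cone ki)) (cn_leg_pt c') comp0c.
- by rewrite /x -hh killed_cone_id -compcA pi comp1c.
Qed.

Section Limit.
Variables (A : P) (c : wlimit (krow K A) T).

(** With [wlimit_mono], this makes the universal leg of any limit cone an inclusion of the joint
    kernel. *)
Lemma wlimit_lift (Z : X) (x : hom Z (T A)) : killed x ->
  exists h, cn_leg c (univ_elt A) \oc h = x.
Proof.
move=> kx; exists (wlim_lift c (killed_cone kx)).
exact: etrans (wlim_liftE c (killed_cone kx) (univ_elt A)) (killed_cone_id kx).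
Qed.

Lemma wlimit_mono (Z : X) (h k : hom Z (cn_apex c)) :
  cn_leg c (univ_elt A) \oc h = cn_leg c (univ_elt A) \oc k -> h = k.
Proof.
move=> hk; apply: wlim_ext => B [[u hu]|]; last by rewrite cn_leg_pt !comp0c.
by rewrite cone_legE !compcA hk.
Qed.
End Limit.

End Kernels.

(** * The direct sum decomposition of $\widehat M$ and the colimits defining it *)

Section Projections.
Variables (P : dkData) (H : dkConditions P).
Notation mor := (mor (dkM P)).
Local Notation K := (dkKernel H).

(* The component at the subobject m of the decomposition
   M(A, B) = \sum_m D(A, S_m): it is r if u = m \oc r with r in R, else 0. *)
Definition proj (S A B : P) (m : mor S B) (w : kcol K B A) : @hom (dkD H) A S :=
  if w is Some u then
    if pselect (sval u = m \oc (star m \oc sval u))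
    then pmk (@inR P A S) (star m \oc sval u) else None
  else None.

#[local] Arguments proj : simpl never.

Lemma proj_pt (S A B : P) (m : mor S B) :
  proj m (pspt (kcol K B) A) = zeroc (A : dkD H) S.
Proof. by []. Qed.

Lemma projE (S A B : P) (m : mor S B) (r : hom A S) (hr : inR r)
    (hu : inMR H (m \oc r)) :
  proj m (Some (exist _ (m \oc r) hu)) = Some (exist _ r hr).
Proof.
rewrite /proj /=; have e : star m \oc (m \oc r) = r.
  by rewrite -compcA starK comp1c.
by rewrite e; case: pselect => //= _; apply: pmkT.
Qed.

Lemma projN (S A B : P) (m : mor S B) (u : hom A B) (hu : inMR H u) :
  (forall r : hom A S, inR r -> u <> m \oc r) ->
  proj m (Some (exist _ u hu)) = None.
Proof.
by move=> nu; rewrite /proj /=; case: pselect => // e; apply: pmkF => /nu.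
Qed.

Lemma proj_id (S B : P) (m : mor S B) (hm : inMR H m) :
  proj m (Some (exist _ (mval m) hm)) = idc (S : dkD H).
Proof.
have -> : Some (exist _ (mval m) hm) =
    Some (exist _ (m \oc idc S) (@inMR_mor P H _ _ _ m _ (@inR_id P S))).
  by congr Some; apply: eq_exist; rewrite compc1.
exact: projE.
Qed.

Lemma proj_nat (S A A1 B : P) (m : mor S B) (r : @hom (dkD H) A1 A)
    (w : kcol K B A) :
  proj m (psmap (kcol K B) r w) = proj m w \oc r.
Proof.
case: w => [[u hu]|]; last by rewrite /= /kact /= Mmap_pt.
case: r => [[r Rr]|]; last by rewrite compc0.
rewrite /= /kact /= /Mmap /= comp1c.
have [[v [Rv uv]]|nv] := pselect (exists v : hom A S, inR v /\ u = m \oc v).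
  rewrite {}uv in hu *; rewrite (projE Rv) /compc /=.
  have [hur|nur] := pselect (inMR H (m \oc v \oc r)).
    have Rvr := inMR_comp_inR Rr Rv hur.
    rewrite (pmkT hur) (pmkT Rvr); move: hur; rewrite compcA => hur.
    exact: projE.
  rewrite (pmkF nur) pmkF // => Rvr; apply: nur; rewrite compcA.
  exact: inMR_mor.
rewrite (projN (m := m) hu) => [|v Rv uv]; last by apply: nv; exists v.
rewrite [RHS](_ : _ = None) //.
have [hur|nur] := pselect (inMR H (u \oc r)); last by rewrite pmkF.
rewrite (pmkT hur); apply: projN => v' Rv' urv'.
(* If u = n v and u r = m v', uniqueness of factorisations identifies n with m, so u would already
   have a component at m. *)
have [S' [n [v [Rv unv]]]] := inMR_decomp hu.
rewrite unv in hur urv'; have Rvr := inMR_comp_inR Rr Rv hur.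
rewrite compcA in urv'; have [b isob [nb _]] := MR_uniq H Rvr Rv' urv'.
apply: nv; exists (b \oc v); split; first exact: inR_isol.
by rewrite unv nb compcA.
Qed.

(** This generates the summand D(-, S) of M(-, B) at m. *)
Definition mor_elt (S B : P) (m : mor S B) : kcol K B S :=
  Some (exist _ (mval m) (@inMR_morE P H _ _ m)).

Lemma proj_rep (B : P) (R : subobj_ranking B) (i j : 'I_(sr_n R)) : i != j ->
  proj (so_mor (sr_rep i)) (mor_elt (so_mor (sr_rep j))) = None.
Proof.
move=> ij; apply: projN => r Rr e.
have e' : so_mor (sr_rep j) \oc idc _ = so_mor (sr_rep i) \oc r.
  by rewrite compc1.
have [b isob [eb _]] := MR_uniq H (@inR_id P _) Rr e'.
by case/eqP: ij; apply/esym/sr_inj; exists b.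
Qed.

Lemma kcol_mor_elt (S A B : P) (m : mor S B) (r : hom A S) (hr : inR r)
    (hu : inMR H (m \oc r)) :
  psmap (kcol K B) (Some (exist _ r hr) : @hom (dkD H) A S) (mor_elt m)
  = Some (exist _ (m \oc r) hu).
Proof. by rewrite /= /kact /= /Mmap /= comp1c; apply: pmkT. Qed.

Section Colimit.
Variables (X : additiveCategory) (F : ptFunctor (dkD H) X) (B : P).

Section Cocone.
Variable c : wcocone (kcol K B) F.

Lemma cocone_legE (S A : P) (m : mor S B) (r : hom A S) (hr : inR r)
    (hu : inMR H (m \oc r)) :
  @cc_leg _ _ _ _ c A (Some (exist _ (m \oc r) hu)) =
  cc_leg c (mor_elt m) \oc fmap F (Some (exist _ r hr) : @hom (dkD H) A S).
Proof. by rewrite -cc_leg_nat; congr cc_leg; rewrite kcol_mor_elt. Qed.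

(** A non-base element has exactly one nonzero component, at the representative of its M-part; the
    comparison isomorphism is absorbed in R. *)
Lemma cocone_decomp (R : subobj_ranking B) (A : dkD H) (w : kcol K B A) :
  \sum_(i < sr_n R) (cc_leg c (mor_elt (so_mor (sr_rep i)))
     \oc fmap F (proj (so_mor (sr_rep i)) w)) = cc_leg c w.
Proof.
case: w => [[u hu]|]; last first.
  rewrite big1 => [|i _]; first exact/esym/(cc_leg_pt c A).
  by rewrite proj_pt ptfunctor0 compc0r.
have [S [m [r [Rr e]]]] := inMR_decomp hu.
have [i [f [isof /= emf]]] := sr_full R (Subobj m).
have Rfr := inR_isol Rr isof.
have {}e : u = so_mor (sr_rep i) \oc (f \oc r) by rewrite e emf compcA.
rewrite {}e in hu *; rewrite (big_only1 i) // => [|j ji _].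
  by rewrite (projE Rfr) (cocone_legE Rfr).
rewrite projN; first by rewrite ptfunctor0 compc0r.
move=> v Rv e.
have [b isob [eb _]] := MR_uniq H Rfr Rv e.
by case/eqP: ji; apply/esym/sr_inj; exists b.
Qed.
End Cocone.

(** By [cocone_decomp], a cocone is freely given by its legs at the generators, that is by a
    morphism out of the direct sum. *)
Lemma wcolimit_exists (Xsum : has_finite_direct_sums X) :
  exists c : wcocone (kcol K B) F, is_wcolimit c.
Proof.
have [R _] := subobj_ranking_exists H B.
have [S [i [p [pi pi0 ip]]]] := direct_sum Xsum
  (fun k : 'I_(sr_n R) => F (so_dom (sr_rep k))).
pose leg (A : dkD H) (w : kcol K B A) : @hom X (F A) S :=
  \sum_(k < sr_n R) (i k \oc fmap F (proj (so_mor (sr_rep k)) w)).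
have leg_pt A : leg A (pspt (kcol K B) A) = zeroc (F A) S.
  by rewrite /leg big1 // => k _; rewrite proj_pt ptfunctor0 compc0r.
have leg_nat (A1 A : dkD H) (r : hom A1 A) (w : kcol K B A) :
    leg A1 (psmap (kcol K B) r w) = leg A w \oc fmap F r.
  rewrite /leg compc_suml; apply: eq_bigr => k _.
  by rewrite proj_nat fmapM compcA.
pose c := @WCocone _ _ (kcol K B) F S leg leg_pt leg_nat.
have leg_rep k : leg _ (mor_elt (so_mor (sr_rep k))) = i k.
  rewrite /leg (big_only1 k) // => [|j jk _].
    by rewrite proj_id fmap1 compc1.
  by rewrite proj_rep // ptfunctor0 compc0r.
exists c => c'.
exists (\sum_(k < sr_n R) (cc_leg c' (mor_elt (so_mor (sr_rep k))) \oc p k)).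
split=> [A w|h hh].
  rewrite -(cocone_decomp c' R w) /= /leg compc_suml; apply: eq_bigr => k _.
  rewrite compcA compc_sumr (big_only1 k) // => [|j jk _].
    by rewrite -[p k \oc _]compcA pi comp1c.
  by rewrite -[p k \oc _]compcA pi0 ?compc0l // eq_sym.
rewrite -[h]compc1 -ip compc_sumr; apply: eq_bigr => k _.
by rewrite -hh /= leg_rep compcA.
Qed.

Variable c : wcolimit (kcol K B) F.

Lemma fmap_proj_nat (S : P) (m : mor S B) (A1 A : dkD H) (r : hom A1 A)
    (w : kcol K B A) :
  fmap F (proj m (psmap (kcol K B) r w)) = fmap F (proj m w) \oc fmap F r.
Proof. by rewrite proj_nat fmapM. Qed.

Definition proj_cocone (S : P) (m : mor S B) : wcocone (kcol K B) F :=
  @WCocone _ _ (kcol K B) F (F S) (fun A w => fmap F (proj m w))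
    (fun A => fmap0 F A S) (fmap_proj_nat m).

Definition colim_proj (S : P) (m : mor S B) : hom (cc_apex c) (F S) :=
  wcolim_desc c (proj_cocone m).

Lemma colim_projE (S : P) (m : mor S B) A (w : kcol K B A) :
  colim_proj m \oc cc_leg c w = fmap F (proj m w).
Proof. exact: (wcolim_descE c (proj_cocone m)). Qed.

(** This gives an arbitrary colimit the coordinates of a direct sum. *)
Lemma colim_sum (R : subobj_ranking B) :
  \sum_(i < sr_n R) (cc_leg c (mor_elt (so_mor (sr_rep i)))
    \oc colim_proj (so_mor (sr_rep i))) = idc (cc_apex c).
Proof.
apply: wcolim_ext => A w; rewrite comp1c compc_suml -[RHS](cocone_decomp c R).
by apply: eq_bigr => i _; rewrite compcA colim_projE.
Qed.

End Colimit.
End Projections.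

(** * Invertibility of the unit and the counit *)

Lemma natTrans_iso (C D : category) (F G : functor C D) (a : natTrans F G) :
  (forall A, is_iso (a A)) -> @is_iso (functorCat C D) F G a.
Proof.
move=> isoa; pose b A := sval (cid (isoa A)).
have ba A : b A \oc a A = idc (F A) by rewrite /b; case: cid => ? [].
have ab A : a A \oc b A = idc (G A) by rewrite /b; case: cid => ? [].
have bnat A B (f : hom A B) : b B \oc fmap G f = fmap F f \oc b A.
  by rewrite -[LHS]compc1 -ab compcA -[_ \oc (a A \oc _)]compcA -nt_nat
    -!compcA ba comp1c.
exists (NatTrans bnat : @hom (functorCat C D) G F).
by split; apply: natTrans_eq => A; [apply: ba|apply: ab].
Qed.

Section Equivalence.
Variables (P : dkData) (H : dkConditions P) (X : additiveCategory).
Notation mor := (mor (dkM P)).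
Local Notation K := (dkKernel H).
Variable colims : forall (F : ptFunctor (dkD H) X) (B : P),
  wcolimit (kcol K B) F.
Variable lims : forall (T : functor P X) (A : dkD H), wlimit (krow K A) T.

Section Unit.
Variables (F : ptFunctor (dkD H) X) (A : P).
Local Notation c := (colims F A).
Local Notation hatF := (hat_ob colims F).

Lemma hat_proj_star (R : subobj_ranking A) (i j : 'I_(sr_n R)) :
  ~ inM (dkM P) (star (so_mor (sr_rep i)) \oc so_mor (sr_rep j)) ->
  colim_proj (colims F (so_dom (sr_rep i))) (mor_id _ _)
    \oc (fmap hatF (star (so_mor (sr_rep i)))
    \oc cc_leg c (mor_elt H (so_mor (sr_rep j)))) = 0.
Proof.
move=> nM; rewrite hat_obE colim_projE.
rewrite /kact /= /Mmap /= compc1 pmkF; last by move/star_mor_MR.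
by rewrite proj_pt ptfunctor0.
Qed.

(* The top component of [fmap hatF (star s_i) \oc x] is the i-th component of
   [x] plus contributions of components of [x] of smaller rank. *)
Lemma killed_proj (R : subobj_ranking A) (Z : X) (x : hom Z (hatF A))
    (i : 'I_(sr_n R)) :
  killed x -> i != sr_top R -> colim_proj c (so_mor (sr_rep i)) \oc x = 0.
Proof.
move=> kx; have [n] := ubnP (sr_rank i); elim: n i => // n IHn i lein itop.
have ni : ~ is_iso (so_mor (sr_rep i)) by move=> /sr_iso_top/eqP; apply/negP.
pose t := colim_proj (colims F (so_dom (sr_rep i))) (mor_id _ _)
  \oc fmap hatF (star (so_mor (sr_rep i))).
have tx : t \oc x = 0 by rewrite /t compcA kx // compc0r.
rewrite -tx -[x in RHS]comp1c -(colim_sum c R) compc_suml compc_sumr.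
rewrite (big_only1 i) // => [|j ji _].
  rewrite /t -!compcA [_ \oc cc_leg _ _]compcA hat_obE colim_projE.
  have -> : kact (idc (_ : dkD H)) (star (so_mor (sr_rep i)))
      (mor_elt H (so_mor (sr_rep i))) = mor_elt H (mor_id _ _).
    rewrite /kact /= /Mmap /= compc1 starK; exact: pmkT.
  by rewrite proj_id fmap1 comp1c.
have [/sr_rankP Mij|nM] :=
    pselect (inM (dkM P) (star (so_mor (sr_rep i)) \oc so_mor (sr_rep j))).
  have ltji : (sr_rank j < sr_rank i)%N by apply: Mij; rewrite eq_sym.
  rewrite [X in t \oc X]compcA IHn ?compc0r //; first exact: leq_trans ltji _.
  (* The induction hypothesis excludes the top, whose rank exceeds that of i. *)
  by apply/eqP => jt; move: ltji; rewrite jt ltnNge ltnW // sr_rank_top.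
by rewrite /t -!compcA [_ \oc cc_leg _ _]compcA hat_proj_star // !compc0l.
Qed.

(** The inverse is the top component of [iota]: as [iota] is killed, [killed_proj] annihilates its
    other components. *)
Lemma unit_iso : is_iso (transp lims (nt_id hatF) A).
Proof.
set eta := transp _ _ _; pose l := lims hatF A.
pose iota := cn_leg l (univ_elt H A).
have id_elt : univ_elt H A = mor_elt H (mor_id _ A).
  by congr Some; apply: eq_exist.
have iota_eta : iota \oc eta = cc_leg c (mor_elt H (mor_id _ A)).
  by apply: etrans (transpE _ _ _) _; rewrite /= comp1c id_elt.
exists (colim_proj c (mor_id _ A) \oc iota); split.
  by rewrite compcA iota_eta colim_projE proj_id fmap1.
apply: wlimit_mono; rewrite -compcA iota_eta compc1.
have [R _] := subobj_ranking_exists H A.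
rewrite -[RHS]comp1c -(colim_sum c R) compc_suml (big_only1 (sr_top R)) //.
  by rewrite sr_topE compcA.
by move=> i ni _; rewrite compcA killed_proj ?compc0r //; apply: cone_killed.
Qed.

End Unit.

Section Counit.
Variable T : functor P X.
Local Notation tT := (tilde_ob lims T).
Local Notation hatT := (hat_ob colims tT).
Local Notation iota A := (cn_leg (lims T A) (univ_elt H A)).
Local Notation eps := (untransp colims (nt_id tT)).

Lemma counit_mor_elt (B S : P) (m : mor S B) :
  eps B \oc cc_leg (colims tT B) (mor_elt H m) = fmap T m \oc iota S.
Proof.
apply: etrans (untranspE _ _ _) _; rewrite compc1.
exact: cone_legE.
Qed.

Lemma counit_mono (B : P) (Z : X) (x : hom Z (hatT B)) :
  eps B \oc x = 0 -> x = 0.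
Proof.
move=> ex; have [R _] := subobj_ranking_exists H B.
pose z (i : 'I_(sr_n R)) := colim_proj (colims tT B) (so_mor (sr_rep i)) \oc x.
suff z0 i : z i = 0.
  rewrite -[x]comp1c -(colim_sum (colims tT B) R) compc_suml big1 // => i _.
  by rewrite compcA [X in _ \oc X]z0 compc0r.
have [n] := ubnP (sr_rank i); elim: n i => // n IHn i lein.
apply: (wlimit_mono (c := lims T _)); rewrite compc0r.
(* In the expansion of this zero, term i is the universal leg applied to z i; each other term has
   either smaller rank or a proper star meeting a killed leg. *)
transitivity (fmap T (star (so_mor (sr_rep i))) \oc (eps B \oc x)); last first.
  by rewrite ex compc0r.
rewrite -[x in RHS]comp1c -(colim_sum (colims tT B) R) compc_suml !compc_sumr.
rewrite (big_only1 i) // => [|j ji _].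
  rewrite compcA -[eps B \oc _]compcA counit_mor_elt -!compcA -fmapM.
  by rewrite starK fmap1 comp1c compcA.
rewrite compcA -[eps B \oc _]compcA counit_mor_elt.
have [Mij|nM] :=
    pselect (inM (dkM P) (star (so_mor (sr_rep i)) \oc so_mor (sr_rep j))).
  rewrite [X in _ \oc (_ \oc X)]IHn ?compc0r //.
  by apply: (leq_trans (sr_rankP Mij _) lein); rewrite eq_sym.
have [C [a [b [e nb]]]] := sr_incompat H nM.
rewrite -!compcA -fmapM e fmapM [_ \oc iota _]compcA.
by rewrite (cone_killed (lims T _)) // compc0r !compc0l.
Qed.

(** By induction on rank every T(s i) factors through the counit; at the top, T(s i) is the
    identity. *)
Lemma counit_split (B : P) :
  exists g : hom (T B) (hatT B), eps B \oc g = idc (T B).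
Proof.
have [R _] := subobj_ranking_exists H B.
suff fac (i : 'I_(sr_n R)) : exists g, fmap T (so_mor (sr_rep i)) = eps B \oc g.
  by have [] := fac (sr_top R); rewrite sr_topE fmap1 => g ->; exists g.
have [n] := ubnP (sr_rank i); elim: n i => // n IHn i lein.
have [q [kq _ qh]] := kernel_idempotent H T (so_dom (sr_rep i)).
have [h ih] := wlimit_lift (lims T (so_dom (sr_rep i))) kq.
have [|w tw] := qh _ _ (fmap T (so_mor (sr_rep i))) (eps B).
  move=> C k /sr_below[l [f [_ /= e]] ltli].
  have [|g eg] := IHn l; first exact: leq_trans ltli _.
  by exists (g \oc fmap T f); rewrite -fmapM e fmapM eg compcA.
(* The first summand yields T(s i) q, the second T(s i) (1 - q). *)
exists ((cc_leg (colims tT B) (mor_elt H (so_mor (sr_rep i))) \oc h) + w).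
rewrite compcDr -tw -compcA counit_mor_elt compcA ih -compcDr.
by rewrite addrC subrK compc1.
Qed.

End Counit.
End Equivalence.

(* The two first conjuncts say that the functors \hat M and \tilde M exist;
   the third one holds for every choice of the (co)limits defining them. *)
Theorem theorem6p7 (P : dkData) (H : dkConditions P) (X : additiveCategory)
    (Xsplit : idempotents_split X) (Xsum : has_finite_direct_sums X) :
  (forall (F : ptFunctor (dkD H) X) (B : P),
     exists c : wcocone (kcol (dkKernel H) B) F, is_wcolimit c) /\
  (forall (T : functor P X) (A : dkD H),
     exists c : wcone (krow (dkKernel H) A) T, is_wlimit c) /\
  (forall (colims : forall (F : ptFunctor (dkD H) X) (B : P),
             wcolimit (kcol (dkKernel H) B) F)
          (lims : forall (T : functor P X) (A : dkD H),
             wlimit (krow (dkKernel H) A) T),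
     is_adjoint_equivalence (kernel_adjunction colims lims)).
Proof.
split; first by move=> F B; apply: wcolimit_exists.
split; first by move=> T A; apply: wlimit_exists.
move=> colims lims; split=> [F|T].
(* The inverse found among all functors serves here, since zero-preserving functors have the same
   transformations. *)
- have [b bE] := @natTrans_iso (dkD H) X _ _
    (transp lims (nt_id (hat_ob colims F))) (unit_iso colims lims F).
  by exists b.
- apply: natTrans_iso => B; apply: mono_split_epi_iso; last exact: counit_split.
  exact: counit_mono.
Qed.
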